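(* In the symplectic induction setting described in the context, the map $\mathbf J^G_M:G\times_H(P\times\mathfrak h_*^\perp)\to\mathfrak g_*$ given by $$\mathbf J^G_M([g,p,\rho^\perp])=\operatorname{Ad}^*_{g^{-1}}\big(\mathbf J^H_P(p)+\rho^\perp\big)$$ is a $G$-equivariant momentum map with respect to the $G$-action $g'\cdot[g,p,\rho^\perp]=[g'g,p,\rho^\perp]$ on the weak symplectic manifold $(G\times_H(P\times\mathfrak h_*^\perp),\Omega)$.
   Context: All manifolds and Lie groups are real Banach; a Banach Lie subgroup is a closed subgroup that is a submanifold. A two-form $\omega$ on a Banach manifold $P$ is weak symplectic if it is closed and $v_p\mapsto\omega(p)(v_p,\cdot)$ is injective for every $p$. $C^\infty_\omega(P)$ is the space of smooth functions $h$ admitting a (necessarily unique) Hamiltonian vector field $X_h$, $\mathbf dh=\omega(X_h,\cdot)$; for $f,h\in C^\infty_\omega(P)$, $\{f,h\}_\omega=\omega(X_f,X_h)$. Momentum map: for a Banach Lie group $G$ with Lie algebra $\mathfrak g$ having a predual $\mathfrak g_*$ invariant under the coadjoint action, a smooth map $\mathbf J:P\to\mathfrak g_*$ is a momentum map if, whenever $\varphi,\psi$ are locally defined smooth functions on $\mathfrak g_*$ such that $\varphi\circ\mathbf J,\psi\circ\mathbf J$ are locally defined elements of $C^\infty_\omega(P)$, one has $\{\varphi\circ\mathbf J,\psi\circ\mathbf J\}_\omega=\{\varphi,\psi\}\circ\mathbf J$, where $\{\varphi,\psi\}(\rho)=\langle[D\varphi(\rho),D\psi(\rho)],\rho\rangle$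 is the Lie-Poisson bracket on $\mathfrak g_*$. $G$-equivariance means $\mathbf J(g\cdot m)=\operatorname{Ad}^*_{g^{-1}}\mathbf J(m)$. Setting. $G$ is a Banach Lie group with Lie algebra $\mathfrak g$, $H\subset G$ a closed Banach Lie subgroup with Lie algebra $\mathfrak h$. Both have preduals $\mathfrak g_*$, $\mathfrak h_*$, invariant under the coadjoint actions of $G$ and $H$ respectively. Assume: - $\mathfrak h_*\subset\mathfrak g_*$ (with the pairing of $\mathfrak h_*$ with $\mathfrak h$ being the restriction of that of $\mathfrak g_*$ with $\mathfrak g$), and there is an $\operatorname{Ad}^*_H$-invariant splitting $\mathfrak g_*=\mathfrak h_*\oplus\mathfrak h_*^\perp$ into Banach subspaces; - $(\mathfrak h_*^\perp)^\circ=\mathfrak h$ ($^\circ$ denotes annihilator). Dualizing gives an $\operatorname{Ad}_H$-invariant splitting $\mathfrak g=\mathfrak h\oplus\mathfrak h^\perp$ with $\mathfrak h^\perp:=(\mathfrak h_* )^\circ$; - $H$ acts smoothly and symplectically on the weak symplectic Banach manifold $(P,\omega)$, and there is a smooth $H$-equivariant map $\mathbf J^H_P:P\to\mathfrak h_*$ such that for all $z\in\mathfrak h$ the function $z\circ\mathbf J^H_P=\langle\mathbf J^H_P(\cdot),z\rangle$ is in $C^\infty_\omega(P)$ and $z_P=X_{z\circ\mathbf J^H_P}$, where $z_P(p)=\frac{d}{dt}|_{t=0}\exp(tz)\cdot p$. $H$ acts on $G\times P\times\mathfrak h_*^\perp$ by $h\cdot(g,p,\rho^\perp)=(gh^{-1},h\cdot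 p,\operatorname{Ad}^*_{h^{-1}}\rho^\perp)$. Standing assumption: the quotient $M=G\times_H(P\times\mathfrak h_*^\perp)=(G\times P\times\mathfrak h_*^\perp)/H$ is a smooth Hausdorff Banach manifold such that the quotient projection $\pi_0$ is a submersion; $[g,p,\rho^\perp]=\pi_0(g,p,\rho^\perp)$. $M$ carries the weak symplectic form $$\begin{aligned} &\Omega(\pi_0(g,p,\rho^\perp))\big(T\pi_0(T_eL_g(x+x^\perp),a_p,\mu^\perp),T\pi_0(T_eL_g(y+y^\perp),b_p,\nu^\perp)\big)\\ &=\omega(p)(a_p,b_p)+\langle T_p\mathbf J^H_P(b_p),x\rangle+\langle\nu^\perp,x^\perp\rangle-\langle T_p\mathbf J^H_P(a_p),y\rangle-\langle\mu^\perp,y^\perp\rangle\\ &\quad+\langle\mathbf J^H_P(p),[x,y]\rangle+\langle\rho^\perp,[x^\perp,y]+[x,y^\perp]\rangle+\langle\mathbf J^H_P(p)+\rho^\perp,[x^\perp,y^\perp]\rangle \end{aligned}$$ for $x,y\in\mathfrak h$, $x^\perp,y^\perp\in\mathfrak h^\perp$, $\mu^\perp,\nu^\perp\in\mathfrak h_*^\perp$, $a_p,b_p\in T_pP$ ($L_g$ is left translation). *)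

(* Defs.v *)
From HB Require Import structures.
From mathcomp Require Import all_boot all_order all_algebra.
From mathcomp Require Import boolp classical_sets functions reals topology.
From mathcomp Require Import normedtype derive.

Set Implicit Arguments.
Unset Strict Implicit.
Unset Printing Implicit Defensive.

Import Order.TTheory GRing.Theory Num.Theory.
Import numFieldNormedType.Exports.

Local Open Scope classical_set_scope.
Local Open Scope ring_scope.

(** The library has no complete normed module structure on products; without
    saturation, products are not even pointed uniform spaces. *)
HB.saturate prod.

Lemma prod_complete (E F : completeType) (A : set_system (E * F)%type) :
  ProperFilter A -> cauchy A -> cvg A.
Proof.
move=> PA cA.
have cA1 : cauchy (fst @ A).
  move=> B entB.
  have [|[P Q] [/= AP AQ] PQ] := cA [set x | B (x.1.1, x.2.1)].
    exists (B, setT); first by split => //; exact: filterT.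
    by move=> [[x1 x2] [y1 y2]] [? _]; exists ((x1, y1), (x2, y2)).
  exists (fst @` P, fst @` Q) => /=.
    by split; [apply: filterS AP|apply: filterS AQ] => z zP; exists z.
  by move=> [x y] /= [[z zP <-] [z' zQ <-]]; exact: (PQ (z, z')).
have cA2 : cauchy (snd @ A).
  move=> B entB.
  have [|[P Q] [/= AP AQ] PQ] := cA [set x | B (x.1.2, x.2.2)].
    exists (setT, B); first by split => //; exact: filterT.
    by move=> [[x1 x2] [y1 y2]] [_ ?]; exists ((x1, y1), (x2, y2)).
  exists (snd @` P, snd @` Q) => /=.
    by split; [apply: filterS AP|apply: filterS AQ] => z zP; exists z.
  by move=> [x y] /= [[z zP <-] [z' zQ <-]]; exact: (PQ (z, z')).
have /cvg_ex[a Aa] : cvg (fst @ A) by exact: cauchy_cvg.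
have /cvg_ex[b Ab] : cvg (snd @ A) by exact: cauchy_cvg.
apply/cvg_ex; exists (a, b) => S [[S1 S2] [/= aS1 bS2] sS].
apply: filterS sS _.
by apply: filterI; [exact: Aa|exact: Ab].
Qed.

HB.instance Definition _ (R : realType) (E F : completeNormedModType R) :=
  Uniform_isComplete.Build (E * F)%type (@prod_complete E F).

(** [Ck k.+1] asks for Frechet differentiability and for the tangent map
    [(x, v) |-> Df(x) v] to be [Ck k].  At a finite order this is slightly
    weaker than continuity of [Df] for the operator norm, but it is implied by
    the usual C^k and implies the usual C^(k-1), so [smooth_on] is the usual
    C^oo.  Only meaningful for open [U]. *)
Fixpoint Ck (R : realType) (k : nat) (E F : normedModType R)
    (U : set E) (f : E -> F) {struct k} : Prop :=
  if k is k'.+1 then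
    (forall x, U x -> differentiable f x) /\
    Ck k' (U `*` [set: E]) (fun p : E * E => 'd f (p.1) p.2)
  else forall x, U x -> {for x, continuous f}.

Definition smooth_on (R : realType) (E F : normedModType R)
    (U : set E) (f : E -> F) : Prop := forall k, Ck k U f.

(** The charts are total functions, meaningful on [dom i]; [ichart i] is the
    inverse of [chart i], meaningful on [chart i @` dom i].  Different charts
    may have different model spaces.  [centre p] selects a chart around [p],
    which is used to represent tangent vectors at [p].  The axioms are in
    [banach_manifold]. *)
Record atlas (R : realType) (T : topologicalType) := Atlas {
  idx : Type;
  model : idx -> completeNormedModType R;
  dom : idx -> set T;
  chart : forall i, T -> model i;
  ichart : forall i, model i -> T;
  centre : T -> idx }.

Arguments chart {R T} a i _.
Arguments ichart {R T} a i _.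
Arguments dom {R T} a i _.

(** [(U, phi)], with inverse [psi], belongs to the maximal atlas; the domain of
    definition of [psi] is [phi @` U]. *)
Definition admissible_chart (R : realType) (T : topologicalType)
    (A : atlas R T) (E : completeNormedModType R)
    (U : set T) (phi : T -> E) (psi : E -> T) : Prop :=
  [/\ [/\ open U, open (phi @` U) & {in U, cancel phi psi}],
      forall p, U p -> {for p, continuous phi},
      forall u, (phi @` U) u -> {for u, continuous psi},
      forall i, smooth_on (phi @` (U `&` dom A i)) (chart A i \o psi)
    & forall i, smooth_on (chart A i @` (U `&` dom A i)) (phi \o ichart A i)].

Definition banach_manifold (R : realType) (T : topologicalType)
    (A : atlas R T) : Prop :=
  [/\ hausdorff_space T,
      forall p, dom A (centre A p) p
    & forall i, admissible_chart A (dom A i) (chart A i) (ichart A i)].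

Definition vs_atlas (R : realType) (E : completeNormedModType R) : atlas R E :=
  @Atlas R E unit (fun=> E) (fun=> [set: E]) (fun=> id) (fun=> id) (fun=> tt).

Definition prod_atlas (R : realType) (S T : topologicalType)
    (A : atlas R S) (B : atlas R T) : atlas R (S * T)%type :=
  @Atlas R (S * T)%type (idx A * idx B)%type
    (fun ij => (model ij.1 * model ij.2)%type)
    (fun ij => dom A ij.1 `*` dom B ij.2)
    (fun ij x => (chart A ij.1 x.1, chart B ij.2 x.2))
    (fun ij u => (ichart A ij.1 u.1, ichart B ij.2 u.2))
    (fun x => (centre A x.1, centre B x.2)).

Definition msmooth_on (R : realType) (S T : topologicalType)
    (A : atlas R S) (B : atlas R T) (U : set S) (f : S -> T) : Prop :=
  (forall p, U p -> {for p, continuous f}) /\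
  forall i j, smooth_on (chart A i @` (U `&` dom A i `&` f @^-1` dom B j))
                        (chart B j \o f \o ichart A i).

Definition msmooth (R : realType) (S T : topologicalType)
    (A : atlas R S) (B : atlas R T) (f : S -> T) : Prop :=
  msmooth_on A B [set: S] f.

(** A tangent vector at [p] is given by its representative in the chart
    [centre A p]. *)
Definition tangent (R : realType) (T : topologicalType) (A : atlas R T)
    (p : T) : completeNormedModType R := model (centre A p).

(** The map T_p f : T_p S -> T_q T, where [q] has to be (propositionally) equal
    to [f p]; it is a separate argument because, e.g., T_(f 1) and T_1 are not
    convertible when [f 1 = 1] has to be proved. *)
Definition Tmap (R : realType) (S T : topologicalType) (A : atlas R S)
    (B : atlas R T) (f : S -> T) (p : S) (q : T) (v : tangent A p) :
    tangent B q :=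
  'd (chart B (centre B q) \o f \o ichart A (centre A p))
     (chart A (centre A p) p) v.

Arguments Tmap {R S T} A B f p q v.

(** Change of representative of a tangent vector at [p], from chart [i] to
    chart [j]. *)
Definition transition (R : realType) (T : topologicalType) (A : atlas R T)
    (p : T) (i j : idx A) (v : model i) : model j :=
  'd (chart A j \o ichart A i) (chart A i p) v.

(** Lang's definition: [f] is locally a projection E1 x E2 -> E1 in suitable
    charts; equivalently, T_p f is onto with complemented kernel. *)
Definition submersion (R : realType) (S T : topologicalType)
    (A : atlas R S) (B : atlas R T) (f : S -> T) : Prop :=
  msmooth A B f /\
  forall p, exists (E1 E2 : completeNormedModType R)
    (U : set S) (phi : S -> (E1 * E2)%type) (psi : (E1 * E2)%type -> S)
    (V : set T) (phi' : T -> E1) (psi' : E1 -> T),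
    [/\ admissible_chart A U phi psi, admissible_chart B V phi' psi',
        U p, f @` U `<=` V & forall q, U q -> phi' (f q) = (phi q).1].

(** [f] identifies the manifold [S] with a (split) submanifold of [T]: around
    each point of the image there is a chart of [T] in which the image is
    E1 x 0, and this chart restricts to a chart of [S]. *)
Definition submanifold (R : realType) (S T : topologicalType)
    (A : atlas R S) (B : atlas R T) (f : S -> T) : Prop :=
  injective f /\
  forall p, exists (E1 E2 : completeNormedModType R)
    (V : set T) (phi : T -> (E1 * E2)%type) (psi : (E1 * E2)%type -> T)
    (psi' : E1 -> S),
    [/\ admissible_chart B V phi psi, V (f p),
        V `&` range f = V `&` [set q | (phi q).2 = 0]
      & admissible_chart A (f @^-1` V) (fun q => (phi (f q)).1) psi'].

Definition form2 (R : realType) (T : topologicalType) (A : atlas R T) :=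
  forall p : T, tangent A p -> tangent A p -> R.

Definition form2_rep (R : realType) (T : topologicalType) (A : atlas R T)
    (w : form2 A) (i : idx A) (u : model i) (a b : model i) : R :=
  let p := ichart A i u in
  w p (transition p (centre A p) a) (transition p (centre A p) b).

Definition is_form2 (R : realType) (T : topologicalType) (A : atlas R T)
    (w : form2 A) : Prop :=
  [/\ forall p a, scalar (w p a),
      forall p a b, w p a b = - w p b a
    & forall i, smooth_on
        ((chart A i @` dom A i) `*` [set: model i] `*` [set: model i])
        (fun x : model i * model i * model i =>
           form2_rep w x.1.1 x.1.2 x.2 : R^o)].

Definition closed_form2 (R : realType) (T : topologicalType) (A : atlas R T)
    (w : form2 A) : Prop :=
  forall i u, (chart A i @` dom A i) u -> forall a b c : model i,
    'd (fun x => form2_rep w x b c : R^o) u a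
    + 'd (fun x => form2_rep w x c a : R^o) u b
    + 'd (fun x => form2_rep w x a b : R^o) u c = 0.

Definition weak_symplectic (R : realType) (T : topologicalType) (A : atlas R T)
    (w : form2 A) : Prop :=
  [/\ is_form2 w, closed_form2 w & forall p, injective (w p)].

Definition vector_field (R : realType) (T : topologicalType) (A : atlas R T) :=
  forall p : T, tangent A p.

Definition vf_smooth_on (R : realType) (T : topologicalType) (A : atlas R T)
    (U : set T) (X : vector_field A) : Prop :=
  forall i, smooth_on (chart A i @` (U `&` dom A i))
    (fun u => let p := ichart A i u in transition p i (X p)).

(** [h] is an element of C^oo_w(U), with Hamiltonian vector field [X] on [U]. *)
Definition hamiltonian_on (R : realType) (T : topologicalType) (A : atlas R T)
    (w : form2 A) (U : set T) (h : T -> R^o) (X : vector_field A) : Prop :=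
  [/\ msmooth_on A (vs_atlas R^o) U h, vf_smooth_on U X
    & forall p, U p -> forall v : tangent A p,
        Tmap A (vs_atlas R^o) h p (h p) v = w p (X p) v].

#[short(type="topGroupType")]
HB.structure Definition TopGroup := {G of Group G & Topological G}.

Definition banach_lie_group (R : realType) (G : topGroupType)
    (A : atlas R G) : Prop :=
  [/\ banach_manifold A,
      msmooth (prod_atlas A A) A (fun x : G * G => (x.1 * x.2)%g)
    & msmooth A A (fun x : G => x^-1%g)].

Definition lie_algebra (R : realType) (G : topGroupType) (A : atlas R G) :
  completeNormedModType R := tangent A 1%g.

Definition TL (R : realType) (G : topGroupType) (A : atlas R G) (g : G) :
    lie_algebra A -> tangent A g :=
  Tmap A A (fun k => (g * k)%g) 1%g g.

Definition Ad (R : realType) (G : topGroupType) (A : atlas R G) (g : G) :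
    lie_algebra A -> lie_algebra A :=
  Tmap A A (fun k => (g * k * g^-1)%g) 1%g 1%g.

(** [x, y] = (T_e Ad)(x) y, which is the bracket of left-invariant vector
    fields. *)
Definition lie_bracket (R : realType) (G : topGroupType) (A : atlas R G)
    (x y : lie_algebra A) : lie_algebra A :=
  Tmap A (vs_atlas (lie_algebra A)) (fun g => Ad g y) 1%g (Ad 1%g y) x.

(** The curves [t |-> e (t x)] are the one-parameter subgroups; this
    characterizes the exponential map. *)
Definition is_exp (R : realType) (G : topGroupType) (A : atlas R G)
    (e : lie_algebra A -> G) : Prop :=
  forall x,
    [/\ msmooth (vs_atlas R^o) A (fun t : R^o => e (t *: x)),
        forall s t : R, e ((s + t) *: x) = (e (s *: x) * e (t *: x))%g
      & Tmap (vs_atlas R^o) A (fun t : R^o => e (t *: x)) 0 1%g 1 = x].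

Definition is_action (G : topGroupType) (T : Type) (act : G -> T -> T) : Prop :=
  (forall p, act 1%g p = p) /\
  (forall g h p, act (g * h)%g p = act g (act h p)).

Definition smooth_action (R : realType) (G : topGroupType) (T : topologicalType)
    (A : atlas R G) (B : atlas R T) (act : G -> T -> T) : Prop :=
  is_action act /\ msmooth (prod_atlas A B) B (fun x : G * T => act x.1 x.2).

Definition symplectic_action (R : realType) (G : topGroupType)
    (T : topologicalType) (B : atlas R T) (w : form2 B)
    (act : G -> T -> T) : Prop :=
  forall g p (a b : tangent B p),
    w (act g p) (Tmap B B (act g) p (act g p) a) (Tmap B B (act g) p (act g p) b) = w p a b.

(** x_T(p) = d/dt exp(tx).p at t = 0. *)
Definition generator (R : realType) (G : topGroupType) (T : topologicalType)
    (A : atlas R G) (B : atlas R T) (e : lie_algebra A -> G)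
    (act : G -> T -> T) (x : lie_algebra A) : vector_field B :=
  fun p => Tmap (vs_atlas R^o) B (fun t : R^o => act (e (t *: x)) p) 0 p 1.

(** The pairing identifies [E], as a Banach space, with the topological dual
    of [Es]. *)
Definition predual (R : realType) (Es E : completeNormedModType R)
    (pair : Es -> E -> R) : Prop :=
  [/\ (forall s, scalar (pair s)) /\ (forall x, scalar (pair ^~ x)),
      exists C, forall s x, `|pair s x| <= C * `|s| * `|x|,
      exists C, forall x M, (forall s, `|pair s x| <= M * `|s|) -> 0 <= M ->
        `|x| <= C * M
    & forall l : {linear Es -> R^o}, continuous l ->
        exists x, forall s, l s = pair s x].

Definition coAd_invariant (R : realType) (G : topGroupType) (A : atlas R G)
    (Es : completeNormedModType R) (pair : Es -> lie_algebra A -> R) : Prop :=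
  forall g s, exists t, forall x, pair t x = pair s (Ad g x).

(** Ad^*_g s, i.e. the functional [s \o Ad g] seen in the predual. *)
Definition coAd (R : realType) (G : topGroupType) (A : atlas R G)
    (Es : completeNormedModType R) (pair : Es -> lie_algebra A -> R)
    (g : G) (s : Es) : Es :=
  xget 0 [set t | forall x, pair t x = pair s (Ad g x)].

(** D phi(s), a continuous linear functional on [Es], as an element of [E]. *)
Definition dual_diff (R : realType) (Es E : completeNormedModType R)
    (pair : Es -> E -> R) (phi : Es -> R^o) (s : Es) : E :=
  xget 0 [set x | forall t, 'd phi s t = pair t x].

Definition lie_poisson (R : realType) (G : topGroupType) (A : atlas R G)
    (Es : completeNormedModType R) (pair : Es -> lie_algebra A -> R)
    (phi psi : Es -> R^o) (s : Es) : R :=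
  pair s (lie_bracket (dual_diff pair phi s) (dual_diff pair psi s)).

Definition momentum_map (R : realType) (G : topGroupType) (A : atlas R G)
    (Es : completeNormedModType R) (pair : Es -> lie_algebra A -> R)
    (T : topologicalType) (B : atlas R T) (w : form2 B) (J : T -> Es) : Prop :=
  msmooth B (vs_atlas Es) J /\
  forall (W : set Es) (phi psi : Es -> R^o) (U : set T) (X Y : vector_field B),
    open W -> smooth_on W phi -> smooth_on W psi ->
    open U -> U `<=` J @^-1` W ->
    hamiltonian_on w U (phi \o J) X -> hamiltonian_on w U (psi \o J) Y ->
    forall m, U m -> w m (X m) (Y m) = lie_poisson pair phi psi (J m).

Definition equivariant (R : realType) (G : topGroupType) (A : atlas R G)
    (Es : completeNormedModType R) (pair : Es -> lie_algebra A -> R)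
    (T : Type) (act : G -> T -> T) (J : T -> Es) : Prop :=
  forall g m, J (act g m) = coAd pair g^-1%g (J m).

(** Topological direct sum E = E1 + E2, with inclusions [j1], [j2] and
    projections [q1], [q2]. *)
Definition splitting (R : realType) (E1 E2 E : completeNormedModType R)
    (j1 : {linear E1 -> E}) (j2 : {linear E2 -> E})
    (q1 : {linear E -> E1}) (q2 : {linear E -> E2}) : Prop :=
  [/\ [/\ continuous j1, continuous j2, continuous q1 & continuous q2],
      cancel j1 q1 /\ cancel j2 q2,
      (forall a, q2 (j1 a) = 0) /\ (forall b, q1 (j2 b) = 0)
    & forall s, s = j1 (q1 s) + j2 (q2 s)].

(* Main.v *)
Require Import Defs.
From HB Require Import structures.
From mathcomp Require Import all_boot all_order all_algebra.
From mathcomp Require Import boolp classical_sets functions reals topology.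
From mathcomp Require Import normedtype derive.
From mathcomp Require Import prodnormedzmodule interval_inference landau.
From mathcomp Require Import ring lra.

Set Implicit Arguments.
Unset Strict Implicit.
Unset Printing Implicit Defensive.

Import Order.TTheory GRing.Theory Num.Theory.
Import numFieldNormedType.Exports.

Local Open Scope classical_set_scope.
Local Open Scope ring_scope.

(** Write [s = JP p + t] and [z = Ad g^-1 xi].  Differentiating
    [<Ad^*_(g^-1) s, xi> = <s, Ad g^-1 xi>] along [(TL g eta, b, nu)] gives
    [<s, [z, eta]> + <T JP b, z> + <nu, z>], because the bracket is the derivative
    of [Ad]; the formula for the symplectic form shows that this is the value of
    [Om] on [Tpi0 (TL g z, 0, 0)] and [Tpi0 (TL g eta, b, nu)].  By weak
    nondegeneracy the Hamiltonian vector field of [phi \o JM] at [[g, p, t]] is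
    therefore [Tpi0 (TL g z, 0, 0)] with [xi = D phi], and the momentum map identity
    reduces to the invariance of the bracket under [Ad].

    Smoothness of [JM] is smoothness of the coadjoint action on the predual.  Since
    [Ad] is smooth jointly in the group and the vector and linear in the vector, the
    remainders of its Taylor expansion in the group variable are small in operator
    norm; dually, they are small on the predual, which is isomorphic to a closed
    subspace of the dual of the Lie algebra by the Hahn-Banach theorem.  So the
    derivative of the coadjoint action exists in the predual and is again of the same
    form, and one concludes by induction on the order.

    Antisymmetry of the bracket comes from the symmetry of second derivatives applied
    to the commutator map of the group. *)

(** * Hahn-Banach and preduals *)

(** Nothing is assumed about how the coadjoint action depends on the group element: [coAd_invariant]
    only represents each functional [x |-> <s, Ad g x>] by an element of the predual. All regularity
    must come from [Ad] by duality, against two obstacles. The derivative of such a functional in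
    [g] lies a priori only in the dual of the Lie algebra; it is represented in the predual because
    it is a limit of difference quotients, uniformly for [x] in bounded sets. And [Ck] controls the
    joint map [(x, v) |-> Df(x) v], not operator norms; these are recovered from joint continuity at
    a zero vector by homogeneity, at the cost of further derivatives. Estimates for vector-valued
    maps come from the real mean value theorem after testing against the predual. Each
    differentiation moves a direction into the parameter, so the argument is run for families over
    open sets of arbitrary normed spaces rather than for [Ad] alone. *)

Section HahnBanach.
Variables (R : realType) (V : normedModType R) (s0 : V).

(* Partial linear functionals bounded by the norm, represented by their graphs;
   the empty graph is allowed so that Zorn's lemma applies to empty chains. *)
Let sublinear_graph (G : set (V * R)) :=
  [/\ forall u r v s a, G (u, r) -> G (v, s) -> G (a *: u + v, a * r + s),
      forall u r, G (u, r) -> r <= `|u|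
    & G !=set0 -> G (s0, `|s0|)].

(** Two values over one [u] differ by a value over [0], which the norm bound makes nonpositive in
    both orders. *)
Let graph_fun G u r s : sublinear_graph G -> G (u, r) -> G (u, s) -> r = s.
Proof.
move=> [lG bG _] Gr Gs.
have lers x y : G (u, x) -> G (u, y) -> x <= y.
  move=> Gx Gy; have := lG _ _ _ _ (-1) Gy Gx.
  by move=> /bG; rewrite scaleN1r addNr normr0 mulN1r addrC subr_le0.
by apply/eqP; rewrite eq_le !lers.
Qed.

(** One-step extension: the value [c] at [v] must lie above every [r - |u - v|] and below every
    [|u + v| - r]. The triangle inequality makes this possible, and [c] is the supremum of the lower
    bounds. *)
Let graph_ext G v : sublinear_graph G -> G !=set0 ->
  exists2 G', sublinear_graph G' & G `<=` G' /\ exists r, G' (v, r).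
Proof.
move=> [lG bG G0] Gn0; 
have Gz : G (0, 0).
  by have := lG _ _ _ _ (-1) (G0 Gn0) (G0 Gn0); rewrite scaleN1r addNr mulN1r addNr.
pose A := [set x | exists u r, G (u, r) /\ x = r - `|u - v|].
have Aub u r : G (u, r) -> ubound A (`|u + v| - r).
  move=> Gu _ [u1 [r1 [Gu1 ->]]].
  rewrite lerBrDr addrAC lerBlDr.
  have /bG := lG _ _ _ _ 1 Gu1 Gu; rewrite scale1r mul1r => /le_trans; apply.
  rewrite [leRHS]addrC.
  have -> : u1 + u = (u1 - v) + (u + v) by rewrite addrACA addNr addr0.
  exact: ler_normD.
have supA : has_sup A.
  split; first by exists (0 - `|0 - v|), 0, 0.
  by exists (`|0 + v| - 0); exact: Aub.
pose c := sup A.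
have c1 u r : G (u, r) -> r - c <= `|u - v|.
  move=> Gu; rewrite lerBlDr -lerBlDl; apply: sup_upper_bound => //.
  by exists u, r.
have c2 u r : G (u, r) -> r + c <= `|u + v|.
  by move=> Gu; rewrite addrC -lerBrDr; apply: ge_sup; [exact: supA.1|exact: Aub].
exists [set z | exists u r a, G (u, r) /\ z = (u + a *: v, r + a * c)].
  split.
  - move=> _ _ _ _ a [u1 [r1 [a1 [G1 [-> ->]]]]] [u2 [r2 [a2 [G2 [-> ->]]]]].
    exists (a *: u1 + u2), (a * r1 + r2), (a * a1 + a2); split; first exact: lG.
    congr pair; first by rewrite scalerDr scalerDl scalerA addrACA.
    by rewrite mulrDr mulrDl mulrA addrACA.
  - move=> _ _ [u [r [a [Gu [-> ->]]]]].
    have Gs b : G (b *: u, b * r).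
      by have := lG _ _ _ _ b Gu Gz; rewrite !addr0.
    (* After division by [|a|], the bound is [c1] for negative [a] and [c2] for positive [a]. *)
    have [a0|a0|->] := ltgtP a 0; last by rewrite mul0r scale0r !addr0; exact: bG.
    + have := c1 _ _ (Gs (- a^-1)).
      rewrite -(ler_pM2l (x := - a)) ?oppr_gt0// mulrBr mulrA mulrNN divff ?lt_eqF//.
      rewrite mul1r mulNr opprK => /le_trans; apply.
      have na0 : 0 <= - a by rewrite oppr_ge0 ltW.
      rewrite -[X in X * `|_|](ger0_norm na0) -normrZ scalerBr scalerA.
      by rewrite mulrNN divff ?lt_eqF// scale1r scaleNr opprK.
    + have := c2 _ _ (Gs (a^-1)).
      rewrite -(ler_pM2l (x := a)) // mulrDr mulrA divff ?gt_eqF//.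
      rewrite mul1r => /le_trans; apply.
      rewrite -[X in X * `|_|](gtr0_norm a0) -normrZ scalerDr scalerA.
      by rewrite divff ?gt_eqF// scale1r.
  - move=> _; exists s0, `|s0|, 0; split; first exact: G0.
    by rewrite scale0r mul0r !addr0.
split.
  by move=> [u r] Gu; exists u, r, 0; split=> //; rewrite scale0r mul0r !addr0.
by exists c; exists 0, 0, 1; split=> //; rewrite scale1r mul1r !add0r.
Qed.

Lemma norming_functional : exists f : {linear V -> R^o},
  (forall v, `|f v| <= `|v|) /\ f s0 = `|s0|.
Proof.
have [|G [PG maxG]] := @Zorn_bigcup (V * R)%type sublinear_graph.
  move=> F FP totF; split.
  - move=> u r v s a [A FA Au] [B FB Bv].
    have [AB|BA] := totF _ _ FA FB.
      by exists B => //; have [lB _ _] := FP _ FB; apply: lB => //; exact: AB.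
    by exists A => //; have [lB _ _] := FP _ FA; apply: lB => //; exact: BA.
  - by move=> u r [A FA Au]; have [_ bA _] := FP _ FA; exact: bA.
  - move=> [z [A FA Az]]; exists A => //; have [_ _ A0] := FP _ FA; apply: A0.
    by exists z.
have Gn0 : G !=set0.
  (* The empty graph is not maximal: the line through [s0] properly extends it. *)
  apply/set0P/negP => /eqP G0.
  apply: (maxG [set z | exists a, z = (a *: s0, a * `|s0|)]).
    rewrite G0; split; first exact: sub0set.
    move=> /(_ (s0, `|s0|)) /=; apply.
    by exists 1; rewrite scale1r mul1r.
  split.
  - move=> _ _ _ _ a [b [-> ->]] [c [-> ->]]; exists (a * b + c).
    by rewrite scalerDl scalerA mulrDl mulrA.
  - move=> _ _ [a [-> ->]]; rewrite normrZ; apply: ler_wpM2r => //; exact: ler_norm.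
  - by move=> _; exists 1; rewrite scale1r mul1r.
have totG v : exists r, G (v, r).
  have [G' PG' [GG' [r Gv]]] := graph_ext v PG Gn0.
  suff <- : G' = G by exists r.
  apply: contrapT => GG; apply: (maxG G' _ PG').
  split=> // G'G; apply: GG; exact/seteqP.
have [f Gf] := choice totG.
have [lG bG G0] := PG.
have lf : linear (f : V -> R^o).
  move=> a u v; apply: (@graph_fun G (a *: u + v)) => //.
  exact: lG.
pose F : {linear V -> R^o} := HB.pack (f : V -> R^o) (GRing.isLinear.Build _ _ _ _ _ lf).
exists F; split; last by apply: (@graph_fun G s0) => //; exact: G0.
move=> v; rewrite ler_norml (bG _ _ (Gf v)) andbT lerNl.
have -> : - F v = F (- v) by rewrite linearN.
by rewrite -normrN; exact: (bG _ _ (Gf (- v))).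
Qed.

End HahnBanach.

Lemma lipschitz_linear_continuous (R : realType) (V W : normedModType R)
  (f : {linear V -> W}) (C : R) : (forall v, `|f v| <= C * `|v|) -> continuous f.
Proof.
move=> fC; apply/bounded_linear_continuous/linear_boundedP.
exists C; split; first exact: num_real.
move=> r Cr v; apply: le_trans (fC v) _.
by apply: ler_wpM2r => //; exact: ltW.
Qed.

Section Predual.
Variables (R : realType) (Es E : completeNormedModType R) (pair : Es -> E -> R).
Hypothesis hp : predual pair.

Lemma pairDl s t x : pair (s + t) x = pair s x + pair t x.
Proof.
have [[_ h] _ _ _] := hp.
by have := h x 1 s t; rewrite scale1r => ->; rewrite mul1r.
Qed.

Lemma pairDr s x y : pair s (x + y) = pair s x + pair s y.
Proof.
have [[h _] _ _ _] := hp.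
by have := h s 1 x y; rewrite scale1r => ->; rewrite mul1r.
Qed.

Lemma pair0l x : pair 0 x = 0.
Proof. by apply: (addrI (pair 0 x)); rewrite -pairDl !addr0. Qed.
Lemma pair0r s : pair s 0 = 0.
Proof. by apply: (addrI (pair s 0)); rewrite -pairDr !addr0. Qed.
Lemma pairZl a s x : pair (a *: s) x = a * pair s x.
Proof. by have [[_ h] _ _ _] := hp; have := h x a s 0; rewrite addr0 pair0l addr0. Qed.
Lemma pairZr a s x : pair s (a *: x) = a * pair s x.
Proof. by have [[h _] _ _ _] := hp; have := h s a x 0; rewrite addr0 pair0r addr0. Qed.
Lemma pairNl s x : pair (- s) x = - pair s x.
Proof. by rewrite -scaleN1r pairZl mulN1r. Qed.
Lemma pairNr s x : pair s (- x) = - pair s x.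
Proof. by rewrite -scaleN1r pairZr mulN1r. Qed.
Lemma pairBl s t x : pair (s - t) x = pair s x - pair t x.
Proof. by rewrite pairDl pairNl. Qed.
Lemma pairBr s x y : pair s (x - y) = pair s x - pair s y.
Proof. by rewrite pairDr pairNr. Qed.

Lemma pair_bound : exists2 C, 0 < C & forall s x, `|pair s x| <= C * `|s| * `|x|.
Proof.
have [_ [C hC] _ _] := hp; exists (`|C| + 1); first by rewrite ltr_pwDr.
move=> s x; apply: le_trans (hC s x) _.
rewrite -!mulrA; apply: ler_wpM2r; first by rewrite mulr_ge0.
by apply: le_trans (ler_norm _) _; rewrite lerDl.
Qed.

(** Hahn-Banach gives a functional of norm at most 1 with value [|s|] at [s]. Duality represents it
    by some [x], and the third clause of [predual] bounds [|x|] independently of [s]. *)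
Lemma predual_norming : exists2 C, 0 < C &
  forall s, exists x, `|x| <= C /\ `|s| <= pair s x.
Proof.
have [_ _ [C hC] hl] := hp; exists (`|C| + 1); first by rewrite ltr_pwDr.
move=> s; have [f [fle fs]] := norming_functional s.
have cf : continuous f.
  by apply: (@lipschitz_linear_continuous _ _ _ _ 1) => v; rewrite mul1r.
have [x hx] := hl f cf; exists x; split; last by rewrite -hx fs.
apply: le_trans (hC x 1 _ _) _ => //.
  by move=> t; rewrite -hx mul1r.
by rewrite mulr1; apply: le_trans (ler_norm _) _; rewrite lerDl.
Qed.

(** The predual embeds isomorphically into the dual of [E], so norm estimates in [Es] may be checked
    on functionals. *)
Lemma predual_norm_le : exists2 C, 0 < C & forall s (M : R), 0 <= M ->
  (forall x, `|pair s x| <= M * `|x|) -> `|s| <= C * M.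
Proof.
have [C C0 hC] := predual_norming; exists C => // s M M0 hM.
have [x [xC sx]] := hC s.
apply: le_trans sx _; apply: le_trans (ler_norm _) _.
by apply: le_trans (hM x) _; rewrite mulrC; apply: ler_wpM2r.
Qed.

Lemma pair_injl s t : (forall x, pair s x = pair t x) -> s = t.
Proof.
move=> st; apply/eqP; rewrite -subr_eq0 -normr_le0.
have [C C0 hC] := predual_norming; have [x [_ hx]] := hC (s - t).
by apply: le_trans hx _; rewrite pairBl st subrr.
Qed.

Lemma pair_norm_le_r : exists2 C, 0 < C & forall x (M : R), 0 <= M ->
  (forall s, `|pair s x| <= M * `|s|) -> `|x| <= C * M.
Proof.
have [_ _ [C hC] _] := hp; exists (`|C| + 1); first by rewrite ltr_pwDr.
move=> x M M0 h; apply: le_trans (hC _ _ h M0) _; apply: ler_wpM2r => //.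
by apply: le_trans (ler_norm _) _; rewrite lerDl.
Qed.

Lemma pair_injr x y : (forall s, pair s x = pair s y) -> x = y.
Proof.
move=> st; apply/eqP; rewrite -subr_eq0 -normr_le0.
have [C C0 hC] := pair_norm_le_r.
rewrite -[leRHS](mulr0 C); apply: hC => // s.
by rewrite pairBr st subrr normr0 mul0r.
Qed.

End Predual.

(** * Calculus of [Ck] and [smooth_on] *)

Lemma near_eq_continuous (S T : topologicalType) (f g : S -> T) x :
  (\near x, f x = g x) -> {for x, continuous f} -> {for x, continuous g}.
Proof.
move=> fg cf; rewrite /prop_for /continuous_at -(nbhs_singleton fg).
by apply: cvg_trans cf; apply: near_eq_cvg.
Qed.

Section Frechet.
Variables (R : realType) (E F : normedModType R).
Implicit Types (f g : E -> F) (x : E).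

Lemma frechetP f x (L : {linear E -> F}) : continuous L ->
  (forall e : R, 0 < e -> \forall y \near x, `|f y - f x - L (y - x)| <= e * `|y - x|) ->
  is_diff x f L.
Proof.
move=> cL h.
have fL : f \o shift x = cst (f x) + L +o_ 0 id.
  apply/eqaddoP => e e0; have := h e e0.
  rewrite (near_shift 0) subr0; apply: filterS => y /=.
  by rewrite addrK !fctE /= opprD addrA.
have dL := diff_unique cL fL.
by apply: DiffDef => //; apply/diff_locallyP; rewrite dL.
Qed.

Lemma differentiable_frechet f x : differentiable f x ->
  forall e : R, 0 < e ->
  \forall y \near x, `|f y - f x - 'd f x (y - x)| <= e * `|y - x|.
Proof.
move=> /diff_locallyP[_ /eqaddoP h] e e0; have := h e e0.
rewrite [X in _ -> X](near_shift 0) subr0; apply: filterS => y /=.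
by rewrite addrK !fctE /= opprD addrA.
Qed.

Lemma near_eq_is_diff f g x : (\near x, f x = g x) -> differentiable f x ->
  is_diff x g ('d f x).
Proof.
move=> fg df; apply: frechetP; first exact: diff_continuous.
move=> e e0; have fgx := nbhs_singleton fg.
near=> y; have <- : f y = g y by near: y.
by rewrite -fgx; near: y; exact: differentiable_frechet.
Unshelve. all: by end_near. Qed.

Lemma near_eq_differentiable f g x : (\near x, f x = g x) ->
  differentiable f x -> differentiable g x.
Proof. by move=> fg df; have [] := near_eq_is_diff fg df. Qed.

Lemma near_eq_diff f g x : (\near x, f x = g x) -> differentiable f x ->
  'd f x = 'd g x :> (E -> F).
Proof. by move=> fg df; have [_ ->] := near_eq_is_diff fg df. Qed.

End Frechet.

Section LinearDiff.
Variables (R : realType) (E F G : normedModType R).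

Lemma is_diff_lin_comp (L : {linear F -> G}) (f : E -> F) x :
  continuous L -> differentiable f x -> is_diff x (L \o f) (L \o 'd f x).
Proof.
move=> cL df; have dL := linear_differentiable (f x) cL.
by apply: DiffDef; [exact: differentiable_comp|rewrite diff_comp// diff_lin].
Qed.

Lemma is_diff_comp_lin (L : {linear E -> F}) (f : F -> G) x :
  continuous L -> differentiable f (L x) -> is_diff x (f \o L) ('d f (L x) \o L).
Proof.
move=> cL df; have dL := linear_differentiable x cL.
by apply: DiffDef; [exact: differentiable_comp|rewrite diff_comp// diff_lin].
Qed.

End LinearDiff.

Lemma open_setX (S T : topologicalType) (A : set S) (B : set T) :
  open A -> open B -> open (A `*` B).
Proof.
move=> oA oB; rewrite openE => -[x y] [/= Ax By].
by exists (A, B) => //; split; exact: open_nbhs_nbhs.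
Qed.

Lemma open_setXT (S T : topologicalType) (A : set S) : open A -> open (A `*` [set: T]).
Proof. by move=> oA; apply: open_setX => //; exact: openT. Qed.

Section CkBasics.
Variable R : realType.
Implicit Types E F G : normedModType R.

Lemma Ck_ext k : forall E F (U : set E) (f g : E -> F), open U ->
  (forall x, U x -> f x = g x) -> Ck k U f -> Ck k U g.
Proof.
elim: k => [|k IH] E F U f g oU fg.
  move=> cf x Ux; apply: near_eq_continuous (cf x Ux).
  by near do apply: fg; exact: open_nbhs_nbhs.
have near_fg x : U x -> \near x, f x = g x.
  by move=> Ux; near do apply: fg; exact: open_nbhs_nbhs.
move=> [df cf]; split.
  by move=> x Ux; apply: near_eq_differentiable (df x Ux); exact: near_fg.
apply: IH cf; first exact: open_setXT.
move=> [x v] [/= Ux _]; apply: (congr1 (fun h => h v)).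
by apply: near_eq_diff; [exact: near_fg|exact: df].
Unshelve. all: by end_near. Qed.

(** [Ck] is a condition at each point of [U], with continuity and differentiability taken in the
    whole space; hence [V] need be neither open nor contained in [U]. *)
Lemma Ck_local k : forall E F (U : set E) (f : E -> F),
  (forall x, U x -> exists2 V, V x & Ck k V f) -> Ck k U f.
Proof.
elim: k => [|k IH] E F U f h.
  by move=> x Ux; have [V Vx] := h x Ux; exact.
split; first by move=> x /h[V Vx [df _]]; exact: df.
by apply: IH => -[x v] [/= /h[V Vx [_ cf]] _]; exists (V `*` setT).
Qed.

Lemma Ck_sub k E F (U V : set E) (f : E -> F) : V `<=` U -> Ck k U f -> Ck k V f.
Proof. by move=> VU cf; apply: Ck_local => x /VU Ux; exists U. Qed.

Lemma Ck_le1 k : forall E F (U : set E) (f : E -> F), Ck k.+1 U f -> Ck k U f.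
Proof.
elim: k => [|k IH] E F U f [df cf].
  by move=> x /df; exact: differentiable_continuous.
by split => //; exact: IH.
Qed.

Lemma Ck_lin_comp k : forall E F G (L : {linear F -> G}) (U : set E) (f : E -> F),
  open U -> continuous L -> Ck k U f -> Ck k U (L \o f).
Proof.
elim: k => [|k IH] E F G L U f oU cL.
  by move=> cf x Ux; apply: continuous_comp; [exact: cf|exact: cL].
move=> [df cf]; split; first by move=> x /df /(is_diff_lin_comp cL)[].
have := IH _ _ _ L _ _ (open_setXT oU) cL cf.
apply: Ck_ext; first exact: open_setXT.
by move=> [x v] [/= /df /(is_diff_lin_comp cL)[_ ->]].
Qed.

(** Proved ahead of the general chain rule, whose induction needs [f \o fst] as a component of the
    tangent map. *)
Lemma Ck_comp_lin k : forall E F G (L : {linear E -> F}) (U : set F) (f : F -> G),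
  open U -> continuous L -> Ck k U f -> Ck k (L @^-1` U) (f \o L).
Proof.
elim: k => [|k IH] E F G L U f oU cL.
  by move=> cf x Ux; apply: continuous_comp; [exact: cL|exact: cf].
have oLU : open (L @^-1` U) by apply: open_comp => // x _; exact: cL.
move=> [df cf]; split; first by move=> x /df /(is_diff_comp_lin cL)[].
have lLL : linear (fun p : E * E => (L p.1, L p.2)).
  by move=> a [u1 u2] [v1 v2] /=; rewrite !linearP.
pose LL : {linear _ -> _} := HB.pack (fun p : E * E => (L p.1, L p.2))
  (GRing.isLinear.Build _ _ _ _ _ lLL).
have cLL : continuous LL.
  move=> p; apply: cvg_pair => /=.
    by apply: (continuous_comp (g := L)); [exact: cvg_fst|exact: cL].
  by apply: (continuous_comp (g := L)); [exact: cvg_snd|exact: cL].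
have := IH _ _ _ LL _ _ (open_setXT oU) cLL cf.
apply: Ck_ext; first exact: (open_setXT (A := L @^-1` U)).
by move=> [x v] [/= /df /(is_diff_comp_lin cL)[_ ->]].
Qed.

Lemma Ck_pair k : forall E F G (U : set E) (f : E -> F) (g : E -> G),
  open U -> Ck k U f -> Ck k U g -> Ck k U (fun x => (f x, g x)).
Proof.
elim: k => [|k IH] E F G U f g oU.
  by move=> cf cg x Ux; apply: cvg_pair; [exact: cf|exact: cg].
move=> [df cf] [dg cg]; split.
  by move=> x Ux; apply: differentiable_pair; [exact: df|exact: dg].
have := IH _ _ _ _ _ _ (open_setXT oU) cf cg.
apply: Ck_ext; first exact: open_setXT.
by move=> [x v] [/= Ux _]; rewrite diff_pair//; [exact: df|exact: dg].
Qed.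

Lemma Ck_cst k E F (U : set E) (c : F) : Ck k U (cst c).
Proof.
elim: k E F U c => [|k IH] E F U c; first by move=> x _; exact: cst_continuous.
split; first by move=> x _; exact: differentiable_cst.
have -> : (fun p : E * E => 'd (cst c : E -> F) (p.1 : E) p.2) = cst (0 : F).
  by apply/funext => -[x v] /=; rewrite diff_cst.
exact: IH.
Qed.

Lemma Ck_lin k E F (L : {linear E -> F}) (U : set E) : continuous L -> Ck k U L.
Proof.
elim: k E F L U => [|k IH] E F L U cL; first by move=> x _; exact: cL.
split; first by move=> x _; exact: linear_differentiable.
have -> : (fun p : E * E => 'd (L : E -> F) (p.1 : E) p.2) = L \o snd.
  by apply/funext => p; rewrite diff_lin.
apply: (@Ck_sub k _ _ setT) => //.
apply: (Ck_comp_lin (U := setT) (L := snd)) => //; first exact: openT.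
  by move=> p; exact: cvg_snd.
exact: IH.
Qed.

Lemma Ck_fst k E F G (U : set E) (f : E -> G) :
  open U -> Ck k U f -> Ck k (U `*` [set: F]) (f \o fst).
Proof.
move=> oU cf; apply: (@Ck_sub k _ _ (fst @^-1` U)); first by move=> p [].
by apply: (Ck_comp_lin (L := fst)) => // p; exact: cvg_fst.
Qed.

(** The tangent map of [g \o f] is that of [g] after [(x, v) |-> (f x, Df(x) v)], to which the
    induction hypothesis applies. *)
Lemma Ck_comp k : forall E F G (U : set E) (V : set F) (f : E -> F) (g : F -> G),
  open U -> open V -> (forall x, U x -> V (f x)) ->
  Ck k U f -> Ck k V g -> Ck k U (g \o f).
Proof.
elim: k => [|k IH] E F G U V f g oU oV fUV.
  by move=> cf cg x Ux; apply: continuous_comp; [exact: cf|exact/cg/fUV].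
move=> Cf; have cf := Ck_le1 Cf; move: Cf => [df cdf] [dg cdg]; split.
  by move=> x Ux; apply: differentiable_comp; [exact: df|exact/dg/fUV].
have cTf : Ck k (U `*` setT) (fun p : E * E => (f p.1, 'd f (p.1 : E) p.2)).
  by apply: (Ck_pair (f := f \o fst)) => //; [exact: open_setXT|exact: Ck_fst].
have UV (p : E * E) : (U `*` [set: E]) p ->
    (V `*` [set: F]) (f p.1, 'd f (p.1 : E) p.2) by move=> [/= /fUV].
have := IH _ _ _ _ _ _ _ (open_setXT oU) (open_setXT oV) UV cTf cdg.
apply: Ck_ext; first exact: open_setXT.
move=> [x v] [/= Ux _]; by rewrite (diff_comp (df _ Ux) (dg _ (fUV _ Ux))).
Qed.

Lemma Ck_add k E F (U : set E) (f g : E -> F) : open U ->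
  Ck k U f -> Ck k U g -> Ck k U (fun x => f x + g x).
Proof.
move=> oU cf cg; have lA : linear (fun p : F * F => p.1 + p.2).
  by move=> a [u1 u2] [v1 v2] /=; rewrite scalerDr addrACA.
pose A : {linear _ -> _} := HB.pack (fun p : F * F => p.1 + p.2)
  (GRing.isLinear.Build _ _ _ _ _ lA).
apply: (Ck_lin_comp (L := A)) (Ck_pair oU cf cg) => //.
exact: add_continuous.
Qed.

Lemma smooth_local E F (U : set E) (f : E -> F) :
  (forall x, U x -> exists2 V, V x & smooth_on V f) -> smooth_on U f.
Proof. by move=> h k; apply: Ck_local => x /h[V Vx /(_ k)]; exists V. Qed.

Lemma smooth_sub E F (U V : set E) (f : E -> F) :
  V `<=` U -> smooth_on U f -> smooth_on V f.
Proof. by move=> VU sf k; apply: Ck_sub (sf k). Qed.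

Lemma smooth_ext E F (U : set E) (f g : E -> F) : open U ->
  (forall x, U x -> f x = g x) -> smooth_on U f -> smooth_on U g.
Proof. by move=> oU fg sf k; apply: Ck_ext (sf k). Qed.

Lemma smooth_comp E F G (U : set E) (V : set F) (f : E -> F) (g : F -> G) :
  open U -> open V -> (forall x, U x -> V (f x)) ->
  smooth_on U f -> smooth_on V g -> smooth_on U (g \o f).
Proof. by move=> oU oV UV sf sg k; apply: Ck_comp UV (sf k) (sg k). Qed.

Lemma smooth_pair E F G (U : set E) (f : E -> F) (g : E -> G) :
  open U -> smooth_on U f -> smooth_on U g -> smooth_on U (fun x => (f x, g x)).
Proof. by move=> oU sf sg k; apply: Ck_pair. Qed.

Lemma smooth_add E F (U : set E) (f g : E -> F) : open U ->
  smooth_on U f -> smooth_on U g -> smooth_on U (fun x => f x + g x).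
Proof. by move=> oU sf sg k; apply: Ck_add. Qed.

Lemma smooth_cst E F (U : set E) (c : F) : smooth_on U (cst c).
Proof. by move=> k; exact: Ck_cst. Qed.

Lemma smooth_lin E F (L : {linear E -> F}) (U : set E) :
  continuous L -> smooth_on U L.
Proof. by move=> cL k; exact: Ck_lin. Qed.

Lemma smooth_differentiable E F (U : set E) (f : E -> F) x :
  smooth_on U f -> U x -> differentiable f x.
Proof. by move=> /(_ 1%N)[df _]; exact: df. Qed.

Lemma smooth_continuous E F (U : set E) (f : E -> F) x :
  smooth_on U f -> U x -> {for x, continuous f}.
Proof. by move=> /(_ 0%N); exact. Qed.

Lemma smooth_diff E F (U : set E) (f : E -> F) :
  smooth_on U f -> smooth_on (U `*` [set: E]) (fun p : E * E => 'd f (p.1 : E) p.2).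
Proof. by move=> sf k; have [] := sf k.+1. Qed.

Lemma smooth_id E (U : set E) : smooth_on U id.
Proof. by apply: (smooth_lin (L := idfun)) => x. Qed.

Lemma smooth_fst E F G (U : set E) (f : E -> (F * G)%type) : open U ->
  smooth_on U f -> smooth_on U (fun x => (f x).1).
Proof.
move=> oU sf k; apply: (Ck_lin_comp (L := fst)) (sf k) => // p.
exact: cvg_fst.
Qed.

Lemma smooth_snd E F G (U : set E) (f : E -> (F * G)%type) : open U ->
  smooth_on U f -> smooth_on U (fun x => (f x).2).
Proof.
move=> oU sf k; apply: (Ck_lin_comp (L := snd)) (sf k) => // p.
exact: cvg_snd.
Qed.

End CkBasics.

(** * Mean value theorem and symmetry of second derivatives *)

Section MeanValue.
Variables (R : realType) (E : normedModType R).
Implicit Types (f : E -> R^o) (x v a b : E).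

Lemma is_diff_shift (F : normedModType R) (f : E -> F) c x : differentiable f (x + c) ->
  is_diff x (fun p => f (p + c)) ('d f (x + c)).
Proof.
move=> df; apply: frechetP; first exact: diff_continuous.
move=> e e0; have := differentiable_frechet df e0.
rewrite [X in X -> _](near_shift x) /=; apply: filterS => y /=.
have -> : y + (x + c - x) = y + c by rewrite [x + c]addrC addrK.
by have -> : y + c - (x + c) = y - x by rewrite opprD addrACA subrr addr0.
Qed.

Lemma segment_MVT f x v : (forall t, 0 <= t <= 1 -> differentiable f (x + t *: v)) ->
  exists2 t, 0 <= t <= 1 & f (x + v) - f x = 'd f (x + t *: v) v.
Proof.
move=> df; pose phi (t : R) : R := f (x + t *: v).
have dphi (t : R) : 0 <= t <= 1 -> is_derive t (1 : R) phi ('d f (x + t *: v) v).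
  move=> /df dft.
  have dl : is_diff t (fun t : R => x + t *: v) ( *:%R^~ v).
    have := is_diffD (is_diff_cst x t) (is_diff_scalel t v).
    by congr is_diff_def; apply/funext => u /=; rewrite !fctE add0r.
  have [dd de] : is_diff t phi ('d f (x + t *: v) \o *:%R^~ v).
    exact: (is_diff_comp dl (differentiableP dft)).
  apply: DeriveDef; first exact: diff_derivable.
  by rewrite deriveE// de /= scale1r.
have [|||t t01 ht] := @MVT_segment R phi (fun t => 'd f (x + t *: v) v) 0 1.
- exact: ler01.
- by move=> t; rewrite in_itv /= => /andP[t0 t1]; apply: dphi; rewrite !ltW.
- apply: derivable_within_continuous => t; rewrite in_itv /= => /dphi[]; exact.
exists t; first by move: t01; rewrite in_itv.
by move: ht; rewrite /phi scale1r scale0r addr0 subr0 mulr1.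
Qed.

(** The mean value theorem is used twice: for the increment [g p = f (p + s b) - f p] along [s a],
    then for the derivative of [f] in direction [a] along [s b]. *)
Lemma second_difference f x a b (U : set E) (s : R) : 0 <= s ->
  (forall p, `|p - x| <= s * (`|a| + `|b|) -> U p) ->
  (forall p, U p -> differentiable f p) ->
  (forall p, U p -> differentiable (fun q => 'd f q a : R^o) p) ->
  exists2 p, `|p - x| <= s * (`|a| + `|b|) &
    f (x + s *: a + s *: b) - f (x + s *: a) - (f (x + s *: b) - f x) =
      s * (s * 'd (fun q => 'd f q a : R^o) p b).
Proof.
move=> s0 hU df dfa.
have near_x t u : 0 <= t <= 1 -> 0 <= u <= 1 ->
    `|x + t *: (s *: a) + u *: (s *: b) - x| <= s * (`|a| + `|b|).
  move=> /andP[t0 t1] /andP[u0 u1].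
  rewrite -(addrA x) [x + _]addrC addrK.
  apply: le_trans (ler_normD _ _) _; rewrite !normrZ !ger0_norm // mulrDr lerD//.
    by rewrite ler_piMl // mulr_ge0.
  by rewrite ler_piMl // mulr_ge0.
pose g p : R^o := f (p + s *: b) - f p.
have dg p : differentiable f (p + s *: b) -> differentiable f p ->
    is_diff p g (fun v => 'd f (p + s *: b) v - 'd f p v).
  move=> d1 d2; exact: (is_diffB (is_diff_shift d1) (differentiableP d2)).
have one : 0 <= (1 : R) <= 1 by rewrite ler01 lexx.
have zero : 0 <= (0 : R) <= 1 by rewrite ler01 lexx.
have d1 t : 0 <= t <= 1 -> differentiable f (x + t *: (s *: a) + s *: b).
  by move=> t01; apply/df/hU; have := near_x t 1 t01 one; rewrite scale1r.
have d2 t : 0 <= t <= 1 -> differentiable f (x + t *: (s *: a)).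
  by move=> t01; apply/df/hU; have := near_x t 0 t01 zero; rewrite scale0r addr0.
have [t t01|t t01 ht] := @segment_MVT g x (s *: a).
  by have [] := dg _ (d1 t t01) (d2 t t01).
have [_ dgt] := dg _ (d1 t t01) (d2 t t01).
have [u u01|u u01 hu] :=
  @segment_MVT (fun q => 'd f q a : R^o) (x + t *: (s *: a)) (s *: b).
  by apply/dfa/hU/near_x.
exists (x + t *: (s *: a) + u *: (s *: b)); first exact: near_x.
move: ht; rewrite /g => ->.
have sZ (L : {linear E -> R^o}) v : L (s *: v) = s * L v := linearZ _ _.
by rewrite dgt !sZ -mulrBr hu sZ.
Qed.

(* Schwarz: both iterated derivatives are limits of the same second difference. *)
Lemma diff_symmetric f x a b (U : set E) : open U -> U x ->
  (forall p, U p -> differentiable f p) ->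
  (forall p, U p -> differentiable (fun q => 'd f q a : R^o) p) ->
  (forall p, U p -> differentiable (fun q => 'd f q b : R^o) p) ->
  {for x, continuous (fun p => 'd (fun q => 'd f q a : R^o) p b : R^o)} ->
  {for x, continuous (fun p => 'd (fun q => 'd f q b : R^o) p a : R^o)} ->
  'd (fun q => 'd f q a : R^o) x b = 'd (fun q => 'd f q b : R^o) x a.
Proof.
move=> oU Ux df da db ca cb; apply/eqP; rewrite -subr_eq0 -normr_le0.
apply/ler_addgt0Pl => e e0; rewrite addr0.
set A := (fun p => 'd (fun q => 'd f q a : R^o) p b : R^o) in ca *.
set B := (fun p => 'd (fun q => 'd f q b : R^o) p a : R^o) in cb *.
have e2 : 0 < e / 2 by rewrite divr_gt0.
have : \forall p \near x, [/\ U p, `|A x - A p| <= e / 2 & `|B x - B p| <= e / 2].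
  near=> p; split; near: p.
  - exact: open_nbhs_nbhs.
  - by move/cvgrPdist_le: ca; apply.
  - by move/cvgrPdist_le: cb; apply.
move=> /nbhs_ballP[d /= d0 hd].
(* Small enough that both intermediate points lie in the ball of radius [d]; the summand 1 covers
   [a = b = 0]. *)
pose s := d / (1 + (`|a| + `|b|)).
have ab0 : 0 < 1 + (`|a| + `|b|) by rewrite ltr_pwDl // addr_ge0.
have s0 : 0 < s by rewrite divr_gt0.
have sd p : `|p - x| <= s * (`|a| + `|b|) -> ball x d p.
  move=> px; rewrite -ball_normE /= distrC; apply: le_lt_trans px _.
  by rewrite /s -mulrA gtr_pMr // ltr_pdivrMl // mulr1 ltrDr.
have sU p : `|p - x| <= s * (`|a| + `|b|) -> U p by move=> /sd /hd[].
have [p px hp] := second_difference (ltW s0) sU df da.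
have [q qx hq] : exists2 q, `|q - x| <= s * (`|a| + `|b|) &
    f (x + s *: a + s *: b) - f (x + s *: a) - (f (x + s *: b) - f x) = s * (s * B q).
  have [|q qx hq] := @second_difference f x b a U s (ltW s0) _ df db.
    by move=> q; rewrite [_ + `|a|]addrC; exact: sU.
  exists q; first by rewrite [`|a| + _]addrC.
  rewrite -hq [x + s *: b + _]addrAC; lra.
have ApBq : A p = B q.
  apply: (mulfI (lt0r_neq0 s0)); apply: (mulfI (lt0r_neq0 s0)).
  by rewrite -hp hq.
have [_ hA _] := hd _ (sd _ px); have [_ _ hB] := hd _ (sd _ qx).
have -> : A x - B x = (A x - A p) - (B x - B q) by rewrite ApBq; lra.
apply: le_trans (ler_normB _ _) _; rewrite [e]splitr; exact: lerD.
Unshelve. all: by end_near. Qed.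

End MeanValue.

(** * Adjoints of smooth families of operators *)

Section PredualClosed.
Variables (R : realType) (Es E : completeNormedModType R) (pair : Es -> E -> R).
Hypothesis hp : predual pair.

(* The predual is complete, hence norm closed in the dual of [E]. *)
Lemma predual_closed (l : E -> R) :
  (forall e : R, 0 < e -> exists s, forall x, `|pair s x - l x| <= e * `|x|) ->
  exists s, forall x, pair s x = l x.
Proof.
move=> hl.
have ex_t (n : nat) : exists s, forall x, `|pair s x - l x| <= n.+1%:R^-1 * `|x|.
  by apply: hl; rewrite invr_gt0.
have [t ht] := choice ex_t.
have [C C0 hC] := predual_norm_le hp.
have tC n m (e : R) : n.+1%:R^-1 <= e -> m.+1%:R^-1 <= e -> `|t n - t m| <= C * (e + e).
  move=> ne me.
  have e0 : 0 <= e by apply: le_trans ne; rewrite invr_ge0.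
  apply: hC => [|x]; first exact: addr_ge0.
  rewrite (pairBl hp).
  have -> : pair (t n) x - pair (t m) x = (pair (t n) x - l x) - (pair (t m) x - l x) by lra.
  apply: le_trans (ler_normB _ _) _; rewrite mulrDl; apply: lerD.
    by apply: le_trans (ht n x) _; apply: ler_wpM2r.
  by apply: le_trans (ht m x) _; apply: ler_wpM2r.
have small (e : R) : 0 < e -> \forall n \near \oo, n.+1%:R^-1 <= e.
  move=> /posnumP[{}e]; have := near_infty_natSinv_lt e.
  by apply: filterS => n /= /ltW.
have ct : cvg (t @ \oo).
  apply: cauchy_cvg; apply: cauchy_exP => e e0 /=.
  (* With precision [e / (4 C)] the bound [tC] becomes [e / 2], which is strictly below [e]. *)
  have C4 : 0 < C *+ 4 by rewrite pmulrn_lgt0.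
  have [N _ hN] := small _ (divr_gt0 e0 C4).
  exists (t N); exists N => // n /= Nn.
  rewrite -ball_normE /=; apply: le_lt_trans (tC _ _ _ (hN N (leqnn N)) (hN n Nn)) _.
  have -> : C * (e / (C *+ 4) + e / (C *+ 4)) = e / 2.
    by field; rewrite lt0r_neq0.
  by rewrite ltr_pdivrMr // ltr_pMr // ltr1n.
have /cvgrPdist_le tlim : t @ \oo --> lim (t @ \oo) := ct.
have [D D0 hD] := pair_bound hp.
exists (lim (t @ \oo)) => x; apply/eqP; rewrite -subr_eq0 -normr_le0.
apply/ler_addgt0Pl => e e0; rewrite addr0.
(* The error from the limit is at most [D d (|x| + 1)] and the one from [t n] at most [d (|x| + 1)];
   they add up to [e]. *)
pose d := e / ((D + 1) * (`|x| + 1)).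
have x1 : 0 < `|x| + 1 by rewrite ltr_wpDl.
have d0 : 0 < d by rewrite divr_gt0 // mulr_gt0 // addr_gt0.
have [n [nl nd]] : exists n, `|lim (t @ \oo) - t n| <= d /\ n.+1%:R^-1 <= d.
  have [N _ hN] := filterI (tlim _ d0) (small _ d0).
  by exists N; apply: hN => /=.
have -> : pair (lim (t @ \oo)) x - l x =
    pair (lim (t @ \oo) - t n) x + (pair (t n) x - l x).
  by rewrite (pairBl hp); lra.
apply: le_trans (ler_normD _ _) _.
have -> : e = D * d * (`|x| + 1) + d * (`|x| + 1).
  rewrite /d; field; rewrite (lt0r_neq0 x1) /= lt0r_neq0 // addr_gt0 //.
apply: lerD.
  apply: le_trans (hD _ _) _; apply: ler_pM => //; last by rewrite lerDl.
    by rewrite mulr_ge0 // ltW.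
  by apply: ler_wpM2l => //; exact: ltW.
by apply: le_trans (ht n x) _; apply: ler_pM => //; rewrite ?lerDl// invr_ge0.
Qed.
End PredualClosed.

Lemma prod_norm_le (R : realType) (E F : normedModType R) (x : E) (y : F) (r : R) :
  (`|(x, y) : E * F| <= r) = (`|x| <= r) && (`|y| <= r).
Proof. by rewrite prod_normE /= ge_max. Qed.

Lemma prod_norm_lt (R : realType) (E F : normedModType R) (x : E) (y : F) (r : R) :
  (`|(x, y) : E * F| < r) = (`|x| < r) && (`|y| < r).
Proof. by rewrite prod_normE /= gt_max. Qed.

(** * Operator-norm estimates for smooth families of linear operators *)

Section LinearFamily.
Variables (R : realType) (E : normedModType R).

Definition linear_family (V : normedModType R) (U : set V) (a : V * E -> E) :=
  smooth_on (U `*` [set: E]) a /\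
  forall u, U u -> linear (fun x => a (u, x)).

(** The direction of differentiation joins the parameter, so the result is again a family of
    operators on [E] and the construction can be iterated. *)
Definition partial1 (V : normedModType R) (a : V * E -> E) : (V * V) * E -> E :=
  fun q => 'd a (q.1.1 : V, q.2) (q.1.2, 0).

Variables (V : normedModType R) (U : set V) (a : V * E -> E).
Hypotheses (oU : open U) (fa : linear_family U a).

Lemma is_diff_partial1 u x : U u ->
  is_diff u (fun u => a (u, x)) (fun v => partial1 a ((u, v), x)).
Proof.
move=> Uu.
have da : differentiable a (u, x) by apply: smooth_differentiable fa.1 _.
have dp : is_diff u (fun u => (u, x)) (fun v => (v, 0 : E)).
  exact: (is_diff_pair (is_diff_id u) (is_diff_cst x u)).
exact: (is_diff_comp dp (differentiableP da)).
Qed.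

Lemma partial1Z u v x c : partial1 a ((u, c *: v), x) = c *: partial1 a ((u, v), x).
Proof.
rewrite /partial1 /= -linearZ; congr ('d _ _ _).
by rewrite -[RHS]/(c *: v, c *: (0 : E)) scaler0.
Qed.

Lemma partial1D u v v' x :
  partial1 a ((u, v + v'), x) = partial1 a ((u, v), x) + partial1 a ((u, v'), x).
Proof.
rewrite /partial1 /= -linearD; congr ('d _ _ _).
by rewrite -[RHS]/(v + v', (0 : E) + 0) addr0.
Qed.

Lemma partial1_family : linear_family (U `*` [set: V]) (partial1 a).
Proof.
split.
  have oUVE : open ((U `*` [set: V]) `*` [set: E]) by do 2!apply: open_setXT.
  pose f (q : (V * V) * E) : (V * E) * (V * E) := ((q.1.1, q.2), (q.1.2, 0)).
  apply: (smooth_comp (f := f) (V := (U `*` [set: E]) `*` [set: V * E]))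
    (smooth_diff fa.1) => //.
    exact/open_setXT/open_setXT.
  have s1 : smooth_on ((U `*` [set: V]) `*` [set: E]) (fun q : (V * V) * E => q.1).
    by apply: smooth_fst => //; exact: smooth_id.
  apply: smooth_pair => //; apply: smooth_pair => //.
  - exact: smooth_fst.
  - by apply: smooth_snd => //; exact: smooth_id.
  - exact: smooth_snd.
  - exact: smooth_cst.
(* Linearity in the vector: differentiate [a (u, c x + y) = c a (u, x) + a (u, y)] in [u]. *)
move=> [u v] [/= Uu _] c x y.
have [_ dxy] := is_diff_partial1 (c *: x + y) Uu.
have [d1 dx] := is_diff_partial1 x Uu.
have [d2 dy] := is_diff_partial1 y Uu.
have := congr1 (fun h => h v) dxy; rewrite /= => <-.
have <- : 'd (fun u => c *: a (u, x) + a (u, y)) u v =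
    'd (fun u => a (u, c *: x + y)) u v.
  apply: (congr1 (fun h => h v)); apply: near_eq_diff.
    near=> u'; have Uu' : U u' by near: u'; exact: open_nbhs_nbhs.
    by rewrite (fa.2 _ Uu').
  exact: (differentiableD (differentiableZ c d1) d2).
rewrite (diffD (differentiableZ c d1) d2) /= (diffZ c d1) /=.
by rewrite [X in c *: X v](_ : _ = fun v => partial1 a ((u, v), x)) // dy.
Unshelve. all: by end_near. Qed.

Lemma family0 u : U u -> a (u, 0) = 0.
Proof.
move=> /fa.2 /(_ 1 0 0); rewrite !scale1r addr0 => h.
by apply: (addrI (a (u, 0))); rewrite addr0 -h.
Qed.

Lemma familyZ u x c : U u -> a (u, c *: x) = c *: a (u, x).
Proof. by move=> Uu; have := fa.2 _ Uu c x 0; rewrite family0 // !addr0. Qed.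

End LinearFamily.

Section LinearFamilyBounds.
Variables (R : realType) (E : normedModType R).
Variables (V : normedModType R) (U : set V) (a : V * E -> E).
Hypotheses (oU : open U) (fa : linear_family U a).

Lemma scale_to_norm (W : normedModType R) (w : W) (r : R) : 0 < r ->
  exists2 w', `|w'| <= r & w = (`|w| / r) *: w'.
Proof.
move=> r0; have [->|w0] := eqVneq w 0.
  by exists 0; rewrite ?normr0 ?scaler0// ltW.
have nw : 0 < `|w| by rewrite normr_gt0.
exists ((r / `|w|) *: w).
  by rewrite normrZ (gtr0_norm (divr_gt0 r0 nw)) divfK ?lt0r_neq0.
by rewrite scalerA mulrA divfK ?lt0r_neq0// divff ?lt0r_neq0// scale1r.
Qed.

(** Joint continuity at [((u0, 0), 0)], where [partial1 a] vanishes, bounds it by 1 on a ball;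
    homogeneity in [v] and in [x] turns this into a bilinear bound uniform in [u]. *)
Lemma partial1_bound u0 : U u0 -> exists d K : R, [/\ 0 < d, 0 < K &
  forall u, `|u - u0| < d -> U u /\
    forall v x, `|partial1 a ((u, v), x)| <= K * `|v| * `|x|].
Proof.
move=> Uu0; have [sa1 la1] := partial1_family oU fa.
have c1 : {for ((u0, 0), 0), continuous (partial1 a)}.
  by apply: smooth_continuous sa1 _.
have : \forall q \near ((u0, 0 : V), 0 : E), U q.1.1 /\ `|partial1 a q| <= 1.
  near=> q; split; near: q.
    have : open (fst @^-1` (fst @^-1` U) : set ((V * V) * E)).
      apply: open_comp => [q _|]; first exact: cvg_fst.
      by apply: open_comp => // q _; exact: cvg_fst.
    by move=> o; exact: open_nbhs_nbhs.
  move/cvgrPdist_le: c1 => /(_ 1 ltr01); apply: filterS => q.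
  by rewrite /partial1 /= -[(0, 0)]/(0 : V * E) linear0 sub0r normrN.
move=> /nbhs_ballP[e /= e0 he].
have hq u v x : `|u - u0| < e -> `|v| < e -> `|x| < e ->
    U u /\ `|partial1 a ((u, v), x)| <= 1.
  move=> ue ve xe; apply: (he ((u, v), x)).
  rewrite prod_norm_ball /ball_ /= prod_norm_lt sub0r normrN xe andbT.
  by rewrite prod_norm_lt distrC ue sub0r normrN.
pose r := e / 2; have r0 : 0 < r by rewrite divr_gt0.
have re : r < e by rewrite ltr_pdivrMr // ltr_pMr // ltr1n.
exists e, (r^-1 * r^-1); split => //; first by rewrite mulr_gt0 // invr_gt0.
move=> u ue; split; first by have [] := hq u 0 0 ue; rewrite ?normr0.
move=> v x; have [v' v'r hv] := scale_to_norm v r0.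
have [x' x'r hx] := scale_to_norm x r0.
have [Uu hvx] := hq u v' x' ue (le_lt_trans v'r re) (le_lt_trans x'r re).
have -> : partial1 a ((u, v), x) = (`|v| / r) *: ((`|x| / r) *: partial1 a ((u, v'), x')).
  by rewrite -(familyZ (partial1_family oU fa)) // -hx -partial1Z -hv.
rewrite !normrZ !normr_id (gtr0_norm (x := r^-1)) ?invr_gt0//.
have -> : r^-1 * r^-1 * `|v| * `|x| = `|v| / r * (`|x| / r * 1).
  by rewrite mulr1 mulrACA [RHS]mulrC mulrA.
by apply: ler_wpM2l; [|apply: ler_wpM2l => //]; rewrite divr_ge0 // ltW.
Unshelve. all: by end_near. Qed.

End LinearFamilyBounds.

Section PairContinuity.
Variables (R : realType) (Es E : completeNormedModType R) (pair : Es -> E -> R).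
Hypothesis hp : predual pair.

Lemma pairl_linear s : linear (pair s : E -> R^o).
Proof. by move=> c x y; rewrite (pairDr hp) (pairZr hp). Qed.

Definition pairl s : {linear E -> R^o} :=
  HB.pack (pair s : E -> R^o) (GRing.isLinear.Build _ _ _ _ _ (pairl_linear s)).

Lemma pairl_continuous s : continuous (pairl s).
Proof.
have [C _ hC] := pair_bound hp.
by apply: lipschitz_linear_continuous => x; exact: hC.
Qed.

Lemma pairr_linear x : linear (pair ^~ x : Es -> R^o).
Proof. by move=> c s t; rewrite (pairDl hp) (pairZl hp). Qed.

Definition pairr x : {linear Es -> R^o} :=
  HB.pack (pair ^~ x : Es -> R^o) (GRing.isLinear.Build _ _ _ _ _ (pairr_linear x)).

Lemma pairr_continuous x : continuous (pairr x).
Proof.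
have [C _ hC] := pair_bound hp.
apply: (lipschitz_linear_continuous (C := C * `|x|)) => s.
by rewrite mulrAC; exact: hC.
Qed.

End PairContinuity.

Section FamilyTaylor.
Variables (R : realType) (Es E : completeNormedModType R) (pair : Es -> E -> R).
Hypothesis hp : predual pair.
Implicit Type V : normedModType R.

(** An equality at an intermediate point holds only for real-valued functions, hence the test
    against [s]; [t] depends on [s] and [x], but the bounds derived from it do not. *)
Lemma family_MVT V (U : set V) (a : V * E -> E) u v x s : open U ->
  linear_family U a -> (forall t, 0 <= t <= 1 -> U (u + t *: v)) ->
  exists2 t, 0 <= t <= 1 &
    pair s (a (u + v, x) - a (u, x)) = pair s (partial1 a ((u + t *: v, v), x)).
Proof.
move=> oU fa hU; pose f (u : V) : R^o := pairl hp s (a (u, x)).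
have df u' : U u' -> is_diff u' f (pairl hp s \o (fun v => partial1 a ((u', v), x))).
  move=> Uu'; have [d1 d2] := is_diff_partial1 fa x Uu'.
  have [dL eL] := is_diff_lin_comp (pairl_continuous (hp := hp) (s := s)) d1.
  by apply: DiffDef => //; rewrite eL d2.
have [|t t01 ht] := @segment_MVT R V f u v; first by move=> t /hU /df[].
exists t => //; rewrite (pairBr hp).
by have [_ dft] := df _ (hU t t01); move: ht; rewrite dft.
Qed.

(** The factor [|x|] is the point: the family is locally Lipschitz in operator norm. [C] undoes the
    test against the predual and [D] bounds the pairing. *)
Lemma family_lipschitz V (U : set V) (a : V * E -> E) u0 : open U ->
  linear_family U a -> U u0 -> exists d K : R, [/\ 0 < d, 0 < K &
    forall u u' x, `|u - u0| < d -> `|u' - u0| < d ->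
      [/\ U u, U u' & `|a (u', x) - a (u, x)| <= K * `|u' - u| * `|x|]].
Proof.
move=> oU fa Uu0; have [d [K [d0 K0 hK]]] := partial1_bound oU fa Uu0.
have [C C0 hC] := pair_norm_le_r hp; have [D D0 hD] := pair_bound hp.
exists d, (C * (D * K)); split => //; first by rewrite !mulr_gt0.
move=> u u' x ud u'd; split; [exact: (hK _ ud).1|exact: (hK _ u'd).1|].
rewrite -!mulrA; apply: hC; first by rewrite !mulr_ge0 // ltW.
move=> s.
have seg t : 0 <= t <= 1 -> `|u + t *: (u' - u) - u0| < d.
  move=> /andP[t0 t1].
  have -> : u + t *: (u' - u) - u0 = (1 - t) *: (u - u0) + t *: (u' - u0).
    rewrite scalerBl scale1r -[RHS]addrA [- _ + _]addrC -scalerBr opprB.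
    by rewrite addrA subrK addrAC.
  apply: le_lt_trans (ler_normD _ _) _; rewrite !normrZ !ger0_norm ?subr_ge0//.
  (* For [t = 1] the weight of the first point vanishes and strictness must come from the second. *)
  have [->|t1'] := eqVneq t 1; first by rewrite subrr mul0r add0r mul1r.
  have tt : 0 < 1 - t by rewrite subr_gt0 lt_neqAle t1' t1.
  have -> : d = (1 - t) * d + t * d by lra.
  by apply: ltr_leD; [rewrite ltr_pM2l|apply: ler_wpM2l => //; exact: ltW].
have [|t t01] := @family_MVT _ U a u (u' - u) x s oU fa.
  by move=> t /seg /hK[].
rewrite [u + _]addrC subrK => ->.
apply: le_trans (hD _ _) _.
have -> : D * (K * (`|u' - u| * `|x|)) * `|s| =
    D * `|s| * (K * `|u' - u| * `|x|) by ring.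
apply: ler_wpM2l; first by rewrite mulr_ge0 // ltW.
by apply: (hK _ (seg t t01)).2.
Qed.

(** The mean value theorem writes the remainder as a difference of two values of [partial1 a], which
    is itself a linear family and therefore Lipschitz in operator norm. *)
Lemma family_taylor V (U : set V) (a : V * E -> E) u0 : open U ->
  linear_family U a -> U u0 -> exists d K : R, [/\ 0 < d, 0 < K &
    forall v x, `|v| < d -> U (u0 + v) /\
      `|a (u0 + v, x) - a (u0, x) - partial1 a ((u0, v), x)| <= K * `|v| * `|v| * `|x|].
Proof.
move=> oU fa Uu0; have fa1 := partial1_family oU fa.
have oUV : open (U `*` [set: V]) by exact: open_setXT.
have [d [K [d0 K0 hK]]] := family_lipschitz (u0 := (u0, 0)) oUV fa1 (conj Uu0 I).
have [C C0 hC] := pair_norm_le_r hp; have [D D0 hD] := pair_bound hp.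
pose r := d / 2; have r0 : 0 < r by rewrite divr_gt0.
have rd : r < d by rewrite ltr_pdivrMr // ltr_pMr // ltr1n.
exists d, (C * (D * K / r)); split => //; first by rewrite mulr_gt0 // divr_gt0 // mulr_gt0.
move=> v x vd.
have near_u0 (v' w : V) : `|v'| < d -> `|w| <= r ->
    `|((u0 + v', w) : (V * V)%type) - (u0, 0)| < d.
  move=> v'd wr; have -> : ((u0 + v', w) : (V * V)%type) - (u0, 0) = (v', w).
    by rewrite -[LHS]/(u0 + v' - u0, w - 0) subr0 [u0 + v']addrC addrK.
  by rewrite prod_norm_lt v'd /=; exact: le_lt_trans rd.
have tv t : 0 <= t <= 1 -> `|t *: v| <= `|v|.
  by move=> /andP[t0 t1]; rewrite normrZ ger0_norm // ler_piMl.
have seg t : 0 <= t <= 1 -> U (u0 + t *: v).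
  move=> /tv t01; have h := near_u0 (t *: v) 0 (le_lt_trans t01 vd).
  have zr : `|0 : V| <= r by rewrite normr0 ltW.
  by have [[]] := hK _ _ 0 (h zr) (h zr).
split; first by have := seg 1; rewrite scale1r; apply; rewrite ler01 lexx.
rewrite -!mulrA; apply: hC; first by rewrite !mulr_ge0 // ?invr_ge0 ltW.
move=> s; rewrite (pairBr hp); have [t t01 ->] := family_MVT x s oU fa seg.
rewrite -(pairBr hp).
(* Used at the direction [v], the Lipschitz bound would give a single power of [|v|]. Rescaling the
   direction to norm at most [r] extracts [|v| / r], and the displacement [t v] of the base point
   supplies the other power. *)
have [v' v'r hv] := scale_to_norm v r0.
have scale_v u : partial1 a ((u, v), x) = (`|v| / r) *: partial1 a ((u, v'), x).
  by rewrite -partial1Z -hv.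
rewrite !scale_v -scalerBr (pairZr hp) normrM.
have n0 : `|((u0, v') : (V * V)%type) - (u0, 0)| < d.
  by have := near_u0 0 v'; rewrite addr0 normr0; apply.
have [_ _] := hK _ _ x n0 (near_u0 (t *: v) v' (le_lt_trans (tv t t01) vd) v'r).
have -> : ((u0 + t *: v, v') : (V * V)%type) - (u0, v') = (t *: v, 0).
  by rewrite -[LHS]/(u0 + t *: v - u0, v' - v') subrr [u0 + _]addrC addrK.
have -> : `|((t *: v, 0) : (V * V)%type)| = `|t *: v|.
  by rewrite prod_normE /= normr0 max_l.
move=> hp1; have vr0 : 0 <= `|v| / r by rewrite divr_ge0 // ltW.
rewrite ger0_norm //.
rewrite [leRHS](_ : _ = `|v| / r * (D * `|s| * (K * `|v| * `|x|))); last by ring.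
apply: ler_wpM2l => //; apply: le_trans (hD _ _) _.
apply: ler_wpM2l; first by rewrite mulr_ge0 // ltW.
apply: le_trans hp1 _; apply: ler_wpM2r => //; apply: ler_wpM2l; first exact: ltW.
exact: tv.
Qed.
End FamilyTaylor.

(** * Differentiation of adjoint families on the predual *)

Section Adjoint.
Variables (R : realType) (Es E : completeNormedModType R) (pair : Es -> E -> R).
Hypothesis hp : predual pair.

Definition adjoint_family (V : normedModType R) (U : set V) (a : V * E -> E)
    (F : V * Es -> Es) :=
  forall u s x, U u -> pair (F (u, s)) x = pair s (a (u, x)).

Definition adjoint1 (V : normedModType R) (a : V * E -> E) (q : (V * V) * Es) : Es :=
  xget 0 [set t | forall x, pair t x = pair q.2 (partial1 a (q.1, x))].

Section Fixed.
Variables (V : normedModType R) (U : set V) (a : V * E -> E) (F : V * Es -> Es).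
Hypotheses (oU : open U) (fa : linear_family U a) (aF : adjoint_family U a F).

(** The difference quotients of [F (_, s)] along [v] lie in [Es], and by [family_taylor] they
    approximate the functional [s \o partial1 a] in the dual norm; [predual_closed] then provides
    the element that [adjoint1] chooses. *)
Lemma adjoint1P : adjoint_family (U `*` [set: V]) (partial1 a) (adjoint1 a).
Proof.
move=> [u v] s x [/= Uu _]; move: x.
suff h : exists t, [set t | forall x, pair t x = pair s (partial1 a ((u, v), x))] t.
  exact: (xgetPex 0 h).
apply: (predual_closed hp) => e e0.
have [d [K [d0 K0 hK]]] := family_taylor hp oU fa Uu.
have [D D0 hD] := pair_bound hp.
pose B := D * `|s| * (K * `|v| * `|v|).
have B0 : 0 <= B by rewrite !mulr_ge0 // ltW.
have B1 : 0 < B + 1 by rewrite ltr_wpDl.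
have v1 : 0 < `|v| + 1 by rewrite ltr_wpDl.
(* The first bound keeps [h v] in the range of the Taylor estimate; the second makes the error [h B]
   of the quotient at most [e]. *)
pose h := Num.min (d / (`|v| + 1)) (e / (B + 1)).
have h0 : 0 < h by rewrite lt_min !divr_gt0.
have hv : `|h *: v| < d.
  rewrite normrZ gtr0_norm //; apply: (@le_lt_trans _ _ (d / (`|v| + 1) * `|v|)).
    by apply: ler_wpM2r => //; rewrite ge_min lexx.
  by rewrite mulrAC ltr_pdivrMr // ltr_pM2l // ltrDl.
exists (h^-1 *: (F (u + h *: v, s) - F (u, s))) => x.
have [Uhv hx] := hK (h *: v) x hv.
rewrite (pairZl hp) (pairBl hp) !aF // -(pairBr hp).
have -> : partial1 a ((u, v), x) = h^-1 *: partial1 a ((u, h *: v), x).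
  by rewrite partial1Z scalerA mulVf ?lt0r_neq0 // scale1r.
rewrite (pairZr hp) -mulrBr -(pairBr hp) normrM gtr0_norm ?invr_gt0//.
rewrite -ler_pdivlMl ?invr_gt0// invrK.
apply: le_trans (hD _ _) _.
apply: (@le_trans _ _ (D * `|s| * (K * `|h *: v| * `|h *: v| * `|x|))).
  by apply: ler_wpM2l => //; rewrite mulr_ge0 // ltW.
rewrite normrZ gtr0_norm //.
rewrite (_ : _ * _ = h * (h * B * `|x|)); last by rewrite /B; ring.
apply: ler_wpM2l; first exact: ltW.
apply: ler_wpM2r => //; apply: (@le_trans _ _ (e / (B + 1) * B)).
  by apply: ler_wpM2r => //; rewrite ge_min lexx orbT.
by rewrite mulrAC ler_pdivrMr // ler_pM2l // lerDl.
Qed.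

Lemma family_bounded u : U u -> exists2 K, 0 < K & forall x, `|a (u, x)| <= K * `|x|.
Proof.
move=> Uu; pose L : {linear E -> E} := HB.pack (fun x => a (u, x))
  (GRing.isLinear.Build _ _ _ _ _ (fa.2 _ Uu)).
have cL : continuous L.
  move=> x; apply: (continuous_comp (f := fun x => (u, x)) (g := a)).
    by apply: cvg_pair; [exact: cvg_cst|exact: cvg_id].
  exact: smooth_continuous fa.1 _.
by have [K K0 hK] := linear_lipschitz cL; exists K.
Qed.

Lemma adjointD u s s' : U u -> F (u, s + s') = F (u, s) + F (u, s').
Proof.
by move=> Uu; apply: (pair_injl hp) => x; rewrite (pairDl hp) !aF // (pairDl hp).
Qed.

Lemma adjointZ u c s : U u -> F (u, c *: s) = c *: F (u, s).
Proof.
by move=> Uu; apply: (pair_injl hp) => x; rewrite (pairZl hp) !aF // (pairZl hp).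
Qed.

Lemma adjoint1D u v v' s : U u ->
  adjoint1 a ((u, v + v'), s) = adjoint1 a ((u, v), s) + adjoint1 a ((u, v'), s).
Proof.
move=> Uu; apply: (pair_injl hp) => x; rewrite (pairDl hp) !adjoint1P //.
by rewrite partial1D (pairDr hp).
Qed.

Lemma adjoint1Z u v c s : U u ->
  adjoint1 a ((u, c *: v), s) = c *: adjoint1 a ((u, v), s).
Proof.
move=> Uu; apply: (pair_injl hp) => x; rewrite (pairZl hp) !adjoint1P //.
by rewrite partial1Z (pairZr hp).
Qed.

(** Only the dependence on [u] has to be expanded, [F] being linear in the second argument.
    Everything is estimated after pairing with [x], where [F] becomes [a]. *)
Lemma is_diff_adjoint u s : U u ->
  is_diff (u, s) F (fun p : V * Es => F (u, p.2) + adjoint1 a ((u, p.1), s)).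
Proof.
move=> Uu; have [C C0 hC] := predual_norm_le hp; have [D D0 hD] := pair_bound hp.
pose l (p : V * Es) := F (u, p.2) + adjoint1 a ((u, p.1), s).
have ll : linear l.
  move=> c [v t] [v' t']; rewrite /l /= adjointD // adjointZ // adjoint1D // adjoint1Z //.
  by rewrite scalerDr addrACA.
pose L : {linear _ -> _} := HB.pack l (GRing.isLinear.Build _ _ _ _ _ ll).
have [K1 K10 hK1] := family_bounded Uu.
have [d2 [K2 [d20 K20 /(_ u)]]] := partial1_bound oU fa Uu.
rewrite subrr normr0 => /(_ d20)[_ hK2].
have [d3 [K3 [d30 K30 hK3]]] := family_lipschitz hp oU fa Uu.
have [d4 [K4 [d40 K40 hK4]]] := family_taylor hp oU fa Uu.
have [C' D'] := (ltW C0, ltW D0).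
have [[[K1' K2'] K3'] K4'] := (ltW K10, ltW K20, ltW K30, ltW K40).
have cL : continuous L.
  apply: (lipschitz_linear_continuous (C := C * (D * K1 + D * `|s| * K2))) => -[v t].
  set N := `|(v, t)|; have N0 : 0 <= N by exact: normr_ge0.
  have [vN tN] : `|v| <= N /\ `|t| <= N.
    by apply/andP; rewrite -prod_norm_le.
  rewrite -(mulrA C); apply: hC.
    by do ?[apply: addr_ge0 | apply: mulr_ge0].
  move=> x; rewrite /= /l /= (pairDl hp) aF // adjoint1P //.
  apply: le_trans (ler_normD _ _) _; rewrite !mulrDl; apply: lerD.
    apply: le_trans (hD _ _) _.
    rewrite (_ : D * K1 * N * `|x| = D * N * (K1 * `|x|)); last by ring.
    by apply: ler_pM => //; [rewrite mulr_ge0 // ltW|apply: ler_wpM2l => //; exact: ltW].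
  apply: le_trans (hD _ _) _.
  rewrite (_ : D * `|s| * K2 * N * `|x| = D * `|s| * (K2 * N * `|x|)); last by ring.
  apply: ler_wpM2l; first by rewrite mulr_ge0 // ltW.
  apply: le_trans (hK2 _ _) _; apply: ler_wpM2r => //; apply: ler_wpM2l => //; exact: ltW.
apply: (@frechetP _ _ _ F (u, s) L cL) => e e0.
(* The remainder will be at most [B N ^ 2], hence at most [e N] as soon as [N < e / (B + 1)]. *)
pose B := C * (D * K3 + D * `|s| * K4).
have B0 : 0 <= B by do ?[apply: addr_ge0 | apply: mulr_ge0].
have B1 : 0 < B + 1 by rewrite ltr_wpDl.
apply/nbhs_normP; exists (Num.min (Num.min d3 d4) (e / (B + 1))) => /=.
  by rewrite !lt_min d30 d40 divr_gt0.
move=> [u' s'] /=; rewrite distrC !lt_min => /andP[/andP[]].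
have -> : (u', s') - (u, s) = (u' - u, s' - s) :> V * Es by [].
set v := u' - u; set t := s' - s; set N := `|(v, t)| => N3 N4 Ne.
have N0 : 0 <= N by exact: normr_ge0.
have [vN tN] : `|v| <= N /\ `|t| <= N by apply/andP; rewrite -prod_norm_le.
have [Uv _] := hK4 v 0 (le_lt_trans vN N4).
have u'E : u' = u + v by rewrite [u + v]addrC subrK.
have s'E : s' = s + t by rewrite [s + t]addrC subrK.
have eB : e = C * (e / C) by rewrite mulrCA divff ?mulr1 // lt0r_neq0.
rewrite [e]eB -(mulrA C); apply: hC.
  by apply: mulr_ge0 => //; apply: divr_ge0 => //; exact: ltW.
move=> x; rewrite /= /l /= u'E s'E adjointD // !(pairBl hp, pairDl hp) !aF // adjoint1P //.
(* A mixed term in [t] and [v], controlled by [family_lipschitz], plus the Taylor remainder at fixed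
   [s]. *)
have -> : pair s (a (u + v, x)) + pair t (a (u + v, x)) - pair s (a (u, x)) -
    (pair t (a (u, x)) + pair s (partial1 a (u, v, x))) =
    pair t (a (u + v, x) - a (u, x)) +
    pair s (a (u + v, x) - a (u, x) - partial1 a (u, v, x)).
  by rewrite !(pairBr hp); ring.
apply: le_trans (ler_normD _ _) _.
have vd3 : `|u + v - u| < d3 by rewrite [u + v]addrC addrK; exact: le_lt_trans vN N3.
have uu : `|u - u| < d3 by rewrite subrr normr0.
have [_ _ hx3] := hK3 u (u + v) x uu vd3.
rewrite [u + v]addrC addrK [v + u]addrC in hx3.
have [_ hx4] := hK4 v x (le_lt_trans vN N4).
apply: (@le_trans _ _ (D * N * (K3 * N * `|x|) + D * `|s| * (K4 * N * N * `|x|))).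
  apply: lerD; apply: le_trans (hD _ _) _.
    apply: ler_pM => //; [exact: mulr_ge0|exact: ler_wpM2l|].
    by apply: le_trans hx3 _; apply: ler_wpM2r => //; exact: ler_wpM2l.
  apply: ler_wpM2l; first exact: mulr_ge0.
  apply: le_trans hx4 _; apply: ler_wpM2r => //.
  apply: ler_pM => //; [exact: mulr_ge0|exact: ler_wpM2l].
rewrite (_ : _ + _ = (D * K3 + D * `|s| * K4) * N * (N * `|x|)); last by ring.
rewrite (_ : e / C * N * `|x| = e / C * (N * `|x|)); last by ring.
apply: ler_wpM2r; first exact: mulr_ge0.
rewrite ler_pdivlMr // mulrC mulrA -/B.
apply: (@le_trans _ _ (B * (e / (B + 1)))); first by apply: ler_wpM2l => //; exact: ltW.
by rewrite mulrA ler_pdivrMr // mulrC ler_pM2l // lerDl.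
Qed.

End Fixed.
End Adjoint.

Section AdjointSmooth.
Variables (R : realType) (Es E : completeNormedModType R) (pair : Es -> E -> R).
Hypothesis hp : predual pair.

(** Both summands of the derivative are adjoint families composed with smooth maps: [F] over [U],
    and [adjoint1] over [U] times [V]. The parameter space therefore varies in the induction. *)
Lemma adjoint_Ck k : forall (V : normedModType R) (U : set V) (a : V * E -> E)
    (F : V * Es -> Es), open U -> linear_family U a ->
  adjoint_family pair U a F -> Ck k (U `*` [set: Es]) F.
Proof.
elim: k => [|k IH] V U a F oU fa aF.
  move=> [u s] [/= Uu _]; apply: differentiable_continuous.
  by have [] := is_diff_adjoint hp oU fa aF s Uu.
split.
  by move=> [u s] [/= Uu _]; have [] := is_diff_adjoint hp oU fa aF s Uu.
have CF := IH _ _ _ _ oU fa aF.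
have oUV : open (U `*` [set: V]) by exact: open_setXT.
have CF1 := IH _ _ _ _ oUV (partial1_family oU fa) (adjoint1P hp oU fa aF).
pose W := ((U `*` [set: Es]) `*` [set: V * Es]).
have oW : open W by do 2!apply: open_setXT.
have s1 : smooth_on W (fun p : (V * Es) * (V * Es) => p.1).
  by apply: smooth_fst => //; exact: smooth_id.
have s2 : smooth_on W (fun p : (V * Es) * (V * Es) => p.2).
  by apply: smooth_snd => //; exact: smooth_id.
have s11 := smooth_fst oW s1; have s12 := smooth_snd oW s1.
have s21 := smooth_fst oW s2; have s22 := smooth_snd oW s2.
have C1 : Ck k W (fun p => F (p.1.1, p.2.2)).
  pose f (p : (V * Es) * (V * Es)) := (p.1.1, p.2.2).
  apply: (Ck_comp (f := f) _ _ _ _ CF) => //.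
  - exact: open_setXT.
  - by move=> [[u s] [v t]] [[/= Uu _] _].
  - exact: (smooth_pair oW s11 s22 k).
have C2 : Ck k W (fun p => adjoint1 pair a ((p.1.1, p.2.1), p.1.2)).
  pose f (p : (V * Es) * (V * Es)) := ((p.1.1, p.2.1), p.1.2).
  apply: (Ck_comp (f := f) _ _ _ _ CF1) => //.
  - exact: open_setXT.
  - exact: (smooth_pair oW (smooth_pair oW s11 s21) s12 k).
apply: Ck_ext (Ck_add oW C1 C2) => //.
by move=> [[u s] [v t]] [[/= Uu _] _]; have [_ ->] := is_diff_adjoint hp oU fa aF s Uu.
Qed.

End AdjointSmooth.

(** * Smooth maps between manifolds *)

Section ContinuousOpen.
Variables (S T : topologicalType).

Lemma open_preimage (f : S -> T) (U : set S) (V : set T) : open U -> open V ->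
  (forall x, U x -> {for x, continuous f}) -> open (U `&` f @^-1` V).
Proof.
move=> oU oV cf; rewrite openE => x [Ux Vfx]; apply: filterI.
  exact: open_nbhs_nbhs.
by apply: (cf x Ux); exact: open_nbhs_nbhs.
Qed.

Lemma for_continuous_pair (Z : topologicalType) (f : Z -> S) (g : Z -> T) z :
  {for z, continuous f} -> {for z, continuous g} ->
  {for z, continuous (fun x => (f x, g x))}.
Proof. by move=> cf cg; exact: cvg_pair. Qed.

Lemma for_continuous_comp (Z : topologicalType) (f : Z -> S) (g : S -> T) z :
  {for z, continuous f} -> {for f z, continuous g} -> {for z, continuous (g \o f)}.
Proof. by move=> cf cg; exact: continuous_comp. Qed.

End ContinuousOpen.

Section Charted.
Variable R : realType.

Record charted (T : topologicalType) (A : atlas R T) : Prop := Charted {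
  dom_centre : forall p, dom A (centre A p) p;
  dom_open : forall i, open (dom A i);
  codom_open : forall i, open (chart A i @` dom A i);
  chartK : forall i p, dom A i p -> ichart A i (chart A i p) = p;
  chart_continuous : forall i p, dom A i p -> {for p, continuous (chart A i)};
  ichart_continuous : forall i p, dom A i p ->
    {for chart A i p, continuous (ichart A i)};
  transition_smooth : forall i j, smooth_on (chart A i @` (dom A i `&` dom A j))
    (chart A j \o ichart A i) }.

Lemma manifold_charted (T : topologicalType) (A : atlas R T) :
  banach_manifold A -> charted A.
Proof.
move=> [_ hc ha]; split=> // [i|i|i p ip|i p ip|i p ip|i j].
- by have [[]] := ha i.
- by have [[]] := ha i.
- by have [[_ _ h]] := ha i; move=> *; apply: h; rewrite inE.
- by have [_ h _ _ _] := ha i; exact: h.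
- by have [_ _ h _ _] := ha i; apply: h; exists p.
- by have [_ _ _ h _] := ha i; exact: h.
Qed.

Lemma vs_charted (E : completeNormedModType R) : charted (vs_atlas E).
Proof.
split=> //= [_|_|i p _|i p _|i j].
- exact: openT.
- by rewrite image_id; exact: openT.
- exact: cvg_id.
- exact: cvg_id.
- exact: smooth_id.
Qed.

Variables (T : topologicalType) (A : atlas R T).
Hypothesis cA : charted A.

Lemma chart_image_open i W : open W -> W `<=` dom A i -> open (chart A i @` W).
Proof.
move=> oW Wi.
have -> : chart A i @` W = (chart A i @` dom A i) `&` ichart A i @^-1` W.
  apply/seteqP; split=> [_ [p Wp <-]|_ [[p ip <-]]] /=.
    by split; [exists p => //; exact: Wi|rewrite (chartK cA)//; exact: Wi].
  by rewrite (chartK cA) // => Wp; exists p.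
apply: open_preimage => //; first exact: codom_open.
by move=> _ [p ip <-]; exact: ichart_continuous.
Qed.

End Charted.

Section ProdCharted.
Variables (R : realType) (S T : topologicalType) (A : atlas R S) (B : atlas R T).
Hypotheses (cA : charted A) (cB : charted B).

Lemma image_prod (X Y X' Y' : Type) (f : X -> X') (g : Y -> Y') (U : set X) (V : set Y) :
  (fun x => (f x.1, g x.2)) @` (U `*` V) = (f @` U) `*` (g @` V).
Proof.
apply/seteqP; split=> [_ [[x y] [/= Ux Vy] <-]|[_ _] [/= [x Ux <-] [y Vy <-]]].
  by split; [exists x|exists y].
by exists (x, y).
Qed.

Lemma prod_charted : charted (prod_atlas A B).
Proof.
split=> /= [p|[i j]|[i j]|[i j] [p q] [/= ip jq]|[i j] [p q] [/= ip jq]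
  |[i j] [p q] [/= ip jq]|[i j] [i' j']].
- by split; exact: dom_centre.
- by apply: open_setX; exact: dom_open.
- by rewrite image_prod; apply: open_setX; exact: codom_open.
- by rewrite !chartK.
- apply: for_continuous_pair.
    apply: (for_continuous_comp (f := fst) (g := chart A i)).
      exact: cvg_fst.
    exact: chart_continuous.
  apply: (for_continuous_comp (f := snd) (g := chart B j)).
    exact: cvg_snd.
  exact: chart_continuous.
- apply: for_continuous_pair.
    apply: (for_continuous_comp (f := fst) (g := ichart A i)).
      exact: cvg_fst.
    exact: ichart_continuous.
  apply: (for_continuous_comp (f := snd) (g := ichart B j)).
    exact: cvg_snd.
  exact: ichart_continuous.
rewrite (_ : (_ `&` _) = (dom A i `&` dom A i') `*` (dom B j `&` dom B j')); last first.
  by apply/seteqP; split=> -[p q] /= [[? ?] [? ?]].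
rewrite image_prod.
have oA : open (chart A i @` (dom A i `&` dom A i')).
  by apply: chart_image_open => //; apply: openI; exact: dom_open.
have oB : open (chart B j @` (dom B j `&` dom B j')).
  by apply: chart_image_open => //; apply: openI; exact: dom_open.
have oAB := open_setX oA oB.
apply: smooth_pair => //.
- apply: (smooth_comp (f := fst) _ oA _ _ (transition_smooth cA i i')) => //.
    by move=> x [].
  by apply: smooth_fst => //; exact: smooth_id.
- apply: (smooth_comp (f := snd) _ oB _ _ (transition_smooth cB j j')) => //.
    by move=> x [].
  by apply: smooth_snd => //; exact: smooth_id.
Qed.

End ProdCharted.

Section LocalSmooth.
Variable R : realType.

Definition lsmooth_in (S T : topologicalType) (A : atlas R S) (B : atlas R T)
    (i : idx A) (j : idx B) (f : S -> T) (p : S) (W : set S) : Prop :=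
  [/\ open W /\ W p, W `<=` dom A i, W `<=` f @^-1` dom B j,
    forall x, W x -> {for x, continuous f}
    & smooth_on (chart A i @` W) (chart B j \o f \o ichart A i)].

(** Smoothness near one point in some pair of charts: easy to establish and to compose, while
    [lsmooth_charts] transfers it to any other charts there. *)
Definition lsmooth (S T : topologicalType) (A : atlas R S) (B : atlas R T)
    (f : S -> T) (p : S) : Prop := exists i j W, lsmooth_in (A := A) (B := B) i j f p W.

Lemma lsmooth_charts (S T : topologicalType) (A : atlas R S) (B : atlas R T)
    (f : S -> T) (p : S) i' j' : charted A -> charted B -> lsmooth A B f p ->
  dom A i' p -> dom B j' (f p) -> exists W, lsmooth_in i' j' f p W.
Proof.
move=> cA cB [i [j [W [[oW Wp] Wi Wj cf sf]]]] ip jfp.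
pose W1 := W `&` f @^-1` dom B j'.
have oW1 : open W1 by apply: open_preimage => //; exact: dom_open.
pose W2 := W1 `&` dom A i'.
have oW2 : open W2 by apply: openI => //; exact: dom_open.
have W2i' : W2 `<=` dom A i' by move=> x [].
have W2i : W2 `<=` dom A i by move=> x [[/Wi]].
exists W2; split=> //.
- by move=> x [[]].
- by move=> x [[/cf]].
have o2 := chart_image_open cA oW2 W2i'.
have o2' := chart_image_open cA oW2 W2i.
have s1 : smooth_on (chart A i' @` W2) (chart A i \o ichart A i').
  apply: smooth_sub (transition_smooth cA i' i) => _ [x W2x <-].
  by exists x => //; split; [exact: W2i'|exact: W2i].
have s2 : smooth_on (chart A i @` W2) (chart B j \o f \o ichart A i).
  by apply: smooth_sub sf => _ [x [[Wx _] _] <-]; exists x.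
have m1 u : (chart A i' @` W2) u -> (chart A i @` W2) ((chart A i \o ichart A i') u).
  by move=> [x W2x <-] /=; rewrite (chartK cA (W2i' _ W2x)); exists x.
have s12 := smooth_comp o2 o2' m1 s1 s2.
have oj : open (chart B j @` (dom B j `&` dom B j')).
  by apply: chart_image_open => //; apply: openI; exact: dom_open.
apply: smooth_ext (smooth_comp o2 oj _ s12 (transition_smooth cB j j')) => //.
  move=> _ [x W2x <-] /=; rewrite (chartK cA (W2i' _ W2x)) (chartK cA (W2i _ W2x)).
  by rewrite (chartK cB) //; case: W2x => [[/Wj]].
move=> _ [x W2x <-] /=; rewrite (chartK cA (W2i' _ W2x)) (chartK cA (W2i _ W2x)).
by exists (f x) => //; case: W2x => [[/Wj]].
Qed.

Lemma lsmooth_comp (S T Z : topologicalType) (A : atlas R S) (B : atlas R T)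
    (C : atlas R Z) (f : S -> T) (g : T -> Z) p : charted A -> charted B -> charted C ->
  lsmooth A B f p -> lsmooth B C g (f p) -> lsmooth A C (g \o f) p.
Proof.
move=> cA cB cC [i [j [W [[oW Wp] Wi Wj cf sf]]]] hg.
have [V [[oV Vp] Vj Vk cg sg]] := lsmooth_charts cB cC hg (Wj _ Wp) (dom_centre cC _).
exists i, (centre C (g (f p))), (W `&` f @^-1` V); split => //.
- by split=> //; exact: open_preimage.
- by move=> x [/Wi].
- by move=> x [_ /Vk].
- by move=> x [/cf ? /cg]; exact: continuous_comp.
have WVi : W `&` f @^-1` V `<=` dom A i by move=> x [/Wi].
have o1 := chart_image_open cA (open_preimage oW oV cf) WVi.
have o2 := chart_image_open cB oV Vj.
have s1 : smooth_on (chart A i @` (W `&` f @^-1` V)) (chart B j \o f \o ichart A i).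
  by apply: smooth_sub sf => _ [x [Wx _] <-]; exists x.
apply: smooth_ext (smooth_comp o1 o2 _ s1 sg) => //.
  move=> _ [x WVx <-] /=; rewrite (chartK cA (WVi _ WVx)).
  by rewrite (chartK cB) //; case: WVx => /Wj.
move=> _ [x WVx <-] /=; rewrite (chartK cA (WVi _ WVx)).
by exists (f x) => //; case: WVx.
Qed.

Lemma lsmooth_pair (S T Z : topologicalType) (A : atlas R S) (B : atlas R T)
    (C : atlas R Z) (f : S -> T) (g : S -> Z) p : charted A -> charted B -> charted C ->
  lsmooth A B f p -> lsmooth A C g p ->
  lsmooth A (prod_atlas B C) (fun x => (f x, g x)) p.
Proof.
move=> cA cB cC hf hg.
have [W [[oW Wp] Wi Wj cf sf]] := lsmooth_charts cA cB hf (dom_centre cA p) (dom_centre cB _).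
have [V [[oV Vp] Vi Vj cg sg]] := lsmooth_charts cA cC hg (dom_centre cA p) (dom_centre cC _).
exists (centre A p), (centre B (f p), centre C (g p)), (W `&` V); split => //=.
- by split=> //; exact: openI.
- by move=> x [/Wi].
- by move=> x [/Wj ? /Vj].
- by move=> x [/cf ? /cg ?]; exact: cvg_pair.
have WVi : W `&` V `<=` dom A (centre A p) by move=> x [/Wi].
have o1 := chart_image_open cA (openI oW oV) WVi.
apply: (smooth_pair o1).
- by apply: smooth_sub sf => _ [x [Wx _] <-]; exists x.
- by apply: smooth_sub sg => _ [x [_ Vx] <-]; exists x.
Qed.

Lemma lsmooth_fst (S T : topologicalType) (A : atlas R S) (B : atlas R T) p :
  charted A -> charted B -> lsmooth (prod_atlas A B) A fst p.
Proof.
move=> cA cB; have cAB := prod_charted cA cB.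
exists (centre A p.1, centre B p.2), (centre A p.1).
exists (dom A (centre A p.1) `*` dom B (centre B p.2)); split => //=.
- split; last by split; exact: dom_centre.
  by apply: open_setX; exact: dom_open.
- by move=> x [].
- by move=> x _; exact: cvg_fst.
have o1 := codom_open cAB (centre A p.1, centre B p.2).
apply: (smooth_ext (f := fst)) => //.
  by move=> _ [x [/= x1 x2] <-] /=; rewrite (chartK cA).
by apply: (smooth_fst (f := id)) => //; exact: smooth_id.
Qed.

Lemma lsmooth_snd (S T : topologicalType) (A : atlas R S) (B : atlas R T) p :
  charted A -> charted B -> lsmooth (prod_atlas A B) B snd p.
Proof.
move=> cA cB; have cAB := prod_charted cA cB.
exists (centre A p.1, centre B p.2), (centre B p.2).
exists (dom A (centre A p.1) `*` dom B (centre B p.2)); split => //=.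
- split; last by split; exact: dom_centre.
  by apply: open_setX; exact: dom_open.
- by move=> x [].
- by move=> x _; exact: cvg_snd.
have o1 := codom_open cAB (centre A p.1, centre B p.2).
apply: (smooth_ext (f := snd)) => //.
  by move=> _ [x [/= x1 x2] <-] /=; rewrite (chartK cB).
by apply: (smooth_snd (f := id)) => //; exact: smooth_id.
Qed.

Lemma lsmooth_cst (S T : topologicalType) (A : atlas R S) (B : atlas R T) c p :
  charted A -> charted B -> lsmooth A B (fun=> c) p.
Proof.
move=> cA cB; exists (centre A p), (centre B c), (dom A (centre A p)); split => //.
- by split; [exact: dom_open|exact: dom_centre].
- by move=> x _; exact: dom_centre.
- by move=> x _; exact: cst_continuous.
- exact: smooth_cst.
Qed.

Lemma lsmooth_id (S : topologicalType) (A : atlas R S) p :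
  charted A -> lsmooth A A id p.
Proof.
move=> cA; exists (centre A p), (centre A p), (dom A (centre A p)); split => //.
- by split; [exact: dom_open|exact: dom_centre].
- by move=> x _; exact: cvg_id.
- apply: (smooth_ext (f := id)); first exact: codom_open.
    by move=> _ [x ix <-] /=; rewrite (chartK cA).
  exact: smooth_id.
Qed.

Lemma smooth_lsmooth (E F : completeNormedModType R) (U : set E) (f : E -> F) x :
  open U -> U x -> smooth_on U f -> lsmooth (vs_atlas E) (vs_atlas F) f x.
Proof.
move=> oU Ux sf; exists tt, tt, U; split => //=.
  by move=> y Uy; exact: smooth_continuous sf Uy.
by rewrite image_id.
Qed.

Lemma msmooth_on_lsmooth (S T : topologicalType) (A : atlas R S) (B : atlas R T)
    (U : set S) (f : S -> T) p : charted A -> charted B ->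
  open U -> U p -> msmooth_on A B U f -> lsmooth A B f p.
Proof.
move=> cA cB oU Up [cf sf].
exists (centre A p), (centre B (f p)).
exists (U `&` dom A (centre A p) `&` f @^-1` dom B (centre B (f p))); split => //.
- split; last by split; [split=> //; exact: dom_centre|exact: dom_centre].
  apply: open_preimage; last by move=> x [/cf].
    by apply: openI => //; exact: dom_open.
  exact: dom_open.
- by move=> x [[]].
- by move=> x [[/cf]].
Qed.

Lemma lsmooth_msmooth (S T : topologicalType) (A : atlas R S) (B : atlas R T)
    (f : S -> T) : charted A -> charted B -> (forall p, lsmooth A B f p) -> msmooth A B f.
Proof.
move=> cA cB sf; split.
  by move=> p _; have [i [j [W [[_ Wp] _ _ cf _]]]] := sf p; exact: cf.
move=> i j; apply: smooth_local => _ [p [[_ ip] jfp] <-].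
have [W [[_ Wp] _ _ _ s]] := lsmooth_charts cA cB (sf p) ip jfp.
by exists (chart A i @` W) => //; exists p.
Qed.

Section Admissible.
Variables (T : topologicalType) (A : atlas R T) (E : completeNormedModType R).
Variables (U : set T) (phi : T -> E) (psi : E -> T).
Hypotheses (cA : charted A) (hphi : admissible_chart A U phi psi).

Lemma admissible_lsmooth p : U p -> lsmooth A (vs_atlas E) phi p.
Proof.
have [[oU oE K] cphi _ _ s] := hphi => Up.
exists (centre A p), tt, (U `&` dom A (centre A p)); split => //.
- split; first by apply: openI => //; exact: dom_open.
  by split=> //; exact: dom_centre.
- by move=> x [/cphi].
Qed.

Lemma admissible_inv_lsmooth p : U p -> lsmooth (vs_atlas E) A psi (phi p).
Proof.
have [[oU oE K] cphi cpsi s _] := hphi => Up.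
have KU x : U x -> psi (phi x) = x by move=> Ux; apply: K; rewrite inE.
pose W := (phi @` U) `&` psi @^-1` (dom A (centre A p)).
have WE : W = phi @` (U `&` dom A (centre A p)).
  apply/seteqP; split=> [_ [[x Ux <-]]|_ [x [Ux ix] <-]] /=.
    by rewrite KU // => ix; exists x.
  by split; [exists x|rewrite /= KU].
exists tt, (centre A p), W; split => //.
- split; first by apply: open_preimage => //; exact: dom_open.
  by rewrite WE; exists p => //; split=> //; exact: dom_centre.
- by move=> x [].
- by move=> x [/cpsi].
- by rewrite /= image_id WE; exact: s.
Qed.

End Admissible.
End LocalSmooth.

(** * Tangent maps *)

Section TangentMap.
Variable R : realType.

(** Charts are total functions, so differentiability of the representative does not keep [f] near
    [p] inside the chart domain at [q]; continuity does, and the chain rule relies on it. *)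
Definition mdiff (S T : topologicalType) (A : atlas R S) (B : atlas R T)
    (f : S -> T) (p : S) (q : T) : Prop :=
  [/\ {for p, continuous f}, f p = q &
    differentiable (chart B (centre B q) \o f \o ichart A (centre A p))
      (chart A (centre A p) p)].

Lemma lsmooth_mdiff (S T : topologicalType) (A : atlas R S) (B : atlas R T) f p q :
  charted A -> charted B -> lsmooth A B f p -> f p = q -> mdiff A B f p q.
Proof.
move=> cA cB hf <-.
have [W [[_ Wp] _ _ cf sf]] := lsmooth_charts cA cB hf (dom_centre cA p) (dom_centre cB _).
by split=> //; [exact: cf|apply: smooth_differentiable sf _; exists p].
Qed.

Section Linear.
Variables (S T : topologicalType) (A : atlas R S) (B : atlas R T).
Variables (f : S -> T) (p : S) (q : T).

Lemma TmapD u v : Tmap A B f p q (u + v) = Tmap A B f p q u + Tmap A B f p q v.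
Proof. exact: linearD. Qed.
Lemma TmapZ c v : Tmap A B f p q (c *: v) = c *: Tmap A B f p q v.
Proof. exact: linearZ. Qed.
Lemma Tmap0 : Tmap A B f p q 0 = 0.
Proof. exact: linear0. Qed.
Lemma TmapN v : Tmap A B f p q (- v) = - Tmap A B f p q v.
Proof. exact: linearN. Qed.
End Linear.

Lemma near_dom (S T : topologicalType) (A : atlas R S) (B : atlas R T) f p j :
  charted A -> charted B -> {for p, continuous f} -> dom B j (f p) ->
  \forall x \near chart A (centre A p) p, dom B j (f (ichart A (centre A p) x)).
Proof.
move=> cA cB cf jp.
have cfi : {for chart A (centre A p) p, continuous (f \o ichart A (centre A p))}.
  apply: for_continuous_comp; first by apply: (ichart_continuous cA); exact: dom_centre.
  by rewrite (chartK cA) //; exact: dom_centre.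
apply: cfi; rewrite /= (chartK cA); last exact: dom_centre.
by apply: open_nbhs_nbhs; split => //; exact: dom_open.
Qed.

Section Comp.
Variables (S T Z : topologicalType) (A : atlas R S) (B : atlas R T) (C : atlas R Z).
Variables (f : S -> T) (g : T -> Z) (p : S) (q : T) (r : Z).
Hypotheses (cA : charted A) (cB : charted B).
Hypotheses (df : mdiff A B f p q) (dg : mdiff B C g q r).

Lemma mdiff_comp_is_diff : is_diff (chart A (centre A p) p)
  (chart C (centre C r) \o (g \o f) \o ichart A (centre A p))
  (Tmap B C g q r \o Tmap A B f p q).
Proof.
have [cf fq dF] := df; have [cg gr dG] := dg.
set F := _ \o _ \o _ in dF; set G := _ \o _ \o _ in dG.
have Fp : F (chart A (centre A p) p) = chart B (centre B q) q.
  by rewrite /F /= (chartK cA) ?fq //; exact: dom_centre.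
rewrite -Fp in dG; rewrite /Tmap -Fp -(diff_comp dF dG).
apply: near_eq_is_diff; last exact: differentiable_comp.
have qp : dom B (centre B q) (f p) by rewrite fq; exact: dom_centre.
have := near_dom cA cB cf qp; apply: filterS => x hx.
by rewrite /G /F /= (chartK cB).
Qed.

Lemma mdiff_comp : mdiff A C (g \o f) p r.
Proof.
have [cf fq dF] := df; have [cg gr dG] := dg.
split; [|by rewrite /= fq gr|by have [] := mdiff_comp_is_diff].
by apply: for_continuous_comp => //; rewrite fq.
Qed.

Lemma Tmap_comp v : Tmap A C (g \o f) p r v = Tmap B C g q r (Tmap A B f p q v).
Proof. by have [_ e] := mdiff_comp_is_diff; rewrite {1}/Tmap e. Qed.

End Comp.

Section Pair.
Variables (S T Z : topologicalType) (A : atlas R S) (B : atlas R T) (C : atlas R Z).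
Variables (f : S -> T) (g : S -> Z) (p : S) (q : T) (r : Z).
Hypotheses (df : mdiff A B f p q) (dg : mdiff A C g p r).

Lemma mdiff_pair : mdiff A (prod_atlas B C) (fun x => (f x, g x)) p (q, r).
Proof.
have [cf fq dF] := df; have [cg gr dG] := dg.
split; [exact: for_continuous_pair|by rewrite fq gr|].
exact: (differentiable_pair dF dG).
Qed.

Lemma Tmap_pair v : Tmap A (prod_atlas B C) (fun x => (f x, g x)) p (q, r) v =
  (Tmap A B f p q v, Tmap A C g p r v).
Proof.
have [_ _ dF] := df; have [_ _ dG] := dg.
exact: (congr1 (fun h => h v) (diff_pair dF dG)).
Qed.

End Pair.

Lemma is_diff_chart_id (S : topologicalType) (A : atlas R S) p : charted A ->
  is_diff (chart A (centre A p) p)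
    (chart A (centre A p) \o ichart A (centre A p)) id.
Proof.
move=> cA; have [d1 e1] := is_diff_id (chart A (centre A p) p).
have : (chart A (centre A p) @` dom A (centre A p)) (chart A (centre A p) p).
  by exists p => //; exact: dom_centre.
move=> h; have near_im := open_nbhs_nbhs (conj (codom_open cA _) h).
have h2 : \forall x \near chart A (centre A p) p,
    id x = (chart A (centre A p) \o ichart A (centre A p)) x.
  by apply: filterS near_im => _ [x ix <-] /=; rewrite (chartK cA).
by have := near_eq_is_diff (f := id) h2 d1; rewrite e1.
Qed.

Lemma mdiff_id (S : topologicalType) (A : atlas R S) p : charted A -> mdiff A A id p p.
Proof.
by move=> cA; split => //; have [] := is_diff_chart_id p cA.
Qed.

Lemma Tmap_id (S : topologicalType) (A : atlas R S) p v : charted A ->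
  Tmap A A id p p v = v.
Proof. by move=> cA; have [_ e] := is_diff_chart_id p cA; rewrite /Tmap e. Qed.

Lemma mdiff_cst (S T : topologicalType) (A : atlas R S) (B : atlas R T) p c :
  mdiff A B (fun=> c) p c.
Proof. by split => //; [exact: cvg_cst|exact: differentiable_cst]. Qed.

Lemma Tmap_cst (S T : topologicalType) (A : atlas R S) (B : atlas R T) p c v :
  Tmap A B (fun=> c) p c v = 0.
Proof. by rewrite /Tmap; exact: (congr1 (fun h => h v) (diff_cst _ _)). Qed.

Section LinearTarget.
Variables (S : topologicalType) (A : atlas R S) (E F : completeNormedModType R).
Variables (L : {linear E -> F}) (f : S -> E) (p : S) (x : E).
Hypotheses (cL : continuous L) (df : mdiff A (vs_atlas E) f p x).

Lemma mdiff_lin : mdiff A (vs_atlas F) (L \o f) p (L x).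
Proof.
have [cf fx dF] := df; split; [|by rewrite /= fx|].
  by apply: for_continuous_comp => //; exact: cL.
by have [d _] := is_diff_lin_comp cL dF; exact: d.
Qed.

Lemma Tmap_lin v : Tmap A (vs_atlas F) (L \o f) p (L x) v = L (Tmap A (vs_atlas E) f p x v).
Proof.
have [cf fx dF] := df; have [_ e] := is_diff_lin_comp cL dF.
exact: (congr1 (fun h => h v) e).
Qed.

End LinearTarget.

Lemma mdiff_vs (E F : completeNormedModType R) (f : E -> F) x :
  differentiable f x -> mdiff (vs_atlas E) (vs_atlas F) f x (f x).
Proof. by move=> df; split => //; exact: differentiable_continuous. Qed.

Lemma Tmap_vs (E F : completeNormedModType R) (f : E -> F) x y v :
  Tmap (vs_atlas E) (vs_atlas F) f x y v = 'd f x v.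
Proof. by []. Qed.

Section Partial.
Variables (S T Z : topologicalType) (A : atlas R S) (B : atlas R T) (C : atlas R Z).
Variables (f : S * T -> Z) (p : S) (q : T) (r : Z).
Hypotheses (cA : charted A) (cB : charted B).
Hypothesis df : mdiff (prod_atlas A B) C f (p, q) r.

Let cAB := prod_charted cA cB.

Lemma Tmap_partial_fst a :
  Tmap (prod_atlas A B) C f (p, q) r (a, 0) = Tmap A C (fun x => f (x, q)) p r a.
Proof.
have dp := mdiff_pair (mdiff_id p cA) (mdiff_cst A B p q).
have := Tmap_comp cA cAB dp df a.
by rewrite (Tmap_pair (mdiff_id p cA) (mdiff_cst A B p q)) (Tmap_id _ cA) Tmap_cst => <-.
Qed.

Lemma Tmap_partial_snd b :
  Tmap (prod_atlas A B) C f (p, q) r (0, b) = Tmap B C (fun y => f (p, y)) q r b.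
Proof.
have dp := mdiff_pair (mdiff_cst B A q p) (mdiff_id q cB).
have := Tmap_comp cB cAB dp df b.
by rewrite (Tmap_pair (mdiff_cst B A q p) (mdiff_id q cB)) (Tmap_id _ cB) Tmap_cst => <-.
Qed.

Lemma Tmap_prod a b : Tmap (prod_atlas A B) C f (p, q) r (a, b) =
  Tmap A C (fun x => f (x, q)) p r a + Tmap B C (fun y => f (p, y)) q r b.
Proof.
rewrite -Tmap_partial_fst -Tmap_partial_snd -TmapD; congr (Tmap _ _ _ _ _ _).
by rewrite -[RHS]/(a + 0, 0 + b) addr0 add0r.
Qed.

End Partial.

End TangentMap.

(** * Adjoint and coadjoint actions *)

Section PartialDiff.
Variables (R : realType) (E F G : normedModType R) (f : E * F -> G) (x : E) (y : F).
Hypothesis df : differentiable f (x, y).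

Lemma is_diff_partial_fst : is_diff x (fun u => f (u, y)) (fun v => 'd f (x, y) (v, 0)).
Proof.
have dp : is_diff x (fun u => (u, y)) (fun v => (v, 0 : F)).
  exact: (is_diff_pair (is_diff_id x) (is_diff_cst y x)).
exact: (is_diff_comp dp (differentiableP df)).
Qed.

Lemma is_diff_partial_snd : is_diff y (fun v => f (x, v)) (fun v => 'd f (x, y) (0, v)).
Proof.
have dp : is_diff y (fun u => (x, u)) (fun v => (0 : E, v)).
  exact: (is_diff_pair (is_diff_cst x y) (is_diff_id y)).
exact: (is_diff_comp dp (differentiableP df)).
Qed.

End PartialDiff.

Section LocalSmoothVs.
Variables (R : realType) (T : topologicalType) (A : atlas R T).
Variables (E : completeNormedModType R) (f : T -> E).
Hypothesis cA : charted A.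

Lemma lsmooth_vs i W p : open W -> W p -> W `<=` dom A i ->
  smooth_on (chart A i @` W) (f \o ichart A i) -> lsmooth A (vs_atlas E) f p.
Proof.
move=> oW Wp Wi sf; exists i, tt, W; split => //= x Wx.
have cf : {for x, continuous ((f \o ichart A i) \o chart A i)}.
  apply: for_continuous_comp; first by apply: (chart_continuous cA); exact: Wi.
  by apply: smooth_continuous sf _; exists x.
apply: near_eq_continuous cf; near=> y => /=; rewrite (chartK cA) //.
by apply: Wi; near: y; exact: open_nbhs_nbhs.
Unshelve. all: by end_near. Qed.

End LocalSmoothVs.

Section LieGroup.
Variables (R : realType) (G : topGroupType) (A : atlas R G).
Hypothesis hG : banach_lie_group A.

Let g := lie_algebra A.

Lemma lie_group_charted : charted A.
Proof. by have [/manifold_charted] := hG. Qed.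

Local Notation cA := lie_group_charted.

Section Closure.
Variables (S : topologicalType) (B : atlas R S).
Hypothesis cB : charted B.

Lemma lsmooth_mulg (f h : S -> G) s : lsmooth B A f s -> lsmooth B A h s ->
  lsmooth B A (fun x => (f x * h x)%g) s.
Proof.
move=> sf sh; have cAA := prod_charted cA cA; have [_ sm _] := hG.
apply: (lsmooth_comp (g := fun x : G * G => (x.1 * x.2)%g) cB cAA cA
  (lsmooth_pair cB cA cA sf sh)).
exact: (msmooth_on_lsmooth cAA cA openT I sm).
Qed.

Lemma lsmooth_invg (f : S -> G) s : lsmooth B A f s ->
  lsmooth B A (fun x => (f x)^-1%g) s.
Proof.
move=> sf; have [_ _ si] := hG.
apply: (lsmooth_comp (g := fun x : G => x^-1%g) cB cA cA sf).
exact: (msmooth_on_lsmooth cA cA openT I si).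
Qed.

End Closure.

Lemma mdiff_mul1 : mdiff (prod_atlas A A) A (fun x => (x.1 * x.2)%g) (1%g, 1%g) 1%g.
Proof.
have cAA := prod_charted cA cA; have [_ sm _] := hG.
apply: lsmooth_mdiff => //; first exact: cA.
  exact: (msmooth_on_lsmooth cAA cA openT I sm).
by rewrite /= mulg1.
Qed.

Lemma Tmap_mul1 (a b : g) :
  Tmap (prod_atlas A A) A (fun x => (x.1 * x.2)%g) (1%g, 1%g) 1%g (a, b) = a + b.
Proof.
rewrite (Tmap_prod cA cA mdiff_mul1) /=.
congr (_ + _).
  rewrite (_ : (fun x : G => (x * 1)%g) = id) ?(Tmap_id _ cA)//.
  by apply/funext => x; rewrite mulg1.
rewrite (_ : (fun x : G => (1 * x)%g) = id) ?(Tmap_id _ cA)//.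
by apply/funext => x; rewrite mul1g.
Qed.

Section TangentMul.
Variables (S : topologicalType) (B : atlas R S) (p : S) (f h : S -> G).
Hypotheses (cB : charted B) (df : mdiff B A f p 1%g) (dh : mdiff B A h p 1%g).

Lemma Tmap_mulg v :
  Tmap B A (fun x => (f x * h x)%g) p 1%g v = Tmap B A f p 1%g v + Tmap B A h p 1%g v.
Proof.
have := Tmap_comp cB (prod_charted cA cA) (mdiff_pair df dh) mdiff_mul1 v.
by rewrite (Tmap_pair df dh) Tmap_mul1.
Qed.

End TangentMul.

Lemma mdiff_inv1 : mdiff A A (fun x => x^-1%g) 1%g 1%g.
Proof.
have [_ _ si] := hG; apply: (lsmooth_mdiff cA cA); last by rewrite invg1.
exact: (msmooth_on_lsmooth cA cA openT I si).
Qed.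

Lemma Tmap_inv1 (v : g) : Tmap A A (fun x => x^-1%g) 1%g 1%g v = - v.
Proof.
have := Tmap_mulg cA (mdiff_id 1%g cA) mdiff_inv1 v.
rewrite (_ : (fun x : G => (id x * x^-1)%g) = fun=> 1%g); last first.
  by apply/funext => x; rewrite mulgV.
by rewrite Tmap_cst (Tmap_id _ cA) addrC => /esym/eqP; rewrite addr_eq0 => /eqP.
Qed.

Definition conjug (x y : G) : G := (x * y * x^-1)%g.

Lemma lsmooth_conjug p : lsmooth (prod_atlas A A) A (fun x : G * G => conjug x.1 x.2) p.
Proof.
have cAA := prod_charted cA cA.
apply: (lsmooth_mulg cAA); last exact: (lsmooth_invg cAA (lsmooth_fst _ cA cA)).
by apply: (lsmooth_mulg cAA); [exact: lsmooth_fst cA cA|exact: lsmooth_snd cA cA].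
Qed.

Lemma mdiff_conjug1 x : mdiff A A (conjug x) 1%g 1%g.
Proof.
have cAA := prod_charted cA cA.
apply: (lsmooth_mdiff cA cA); last by rewrite /conjug mulg1 mulgV.
apply: (lsmooth_comp (f := fun y : G => (x, y)) cA cAA cA _ (lsmooth_conjug (x, 1%g))).
exact: (lsmooth_pair cA cA cA (lsmooth_cst x 1%g cA cA) (lsmooth_id 1%g cA)).
Qed.

Lemma AdD x (u v : g) : Ad x (u + v) = Ad x u + Ad x v. Proof. exact: TmapD. Qed.
Lemma AdZ x c (v : g) : Ad x (c *: v) = c *: Ad x v. Proof. exact: TmapZ. Qed.
Lemma Ad1 (v : g) : Ad 1%g v = v.
Proof.
rewrite /Ad (_ : (fun k : G => (1 * k * 1^-1)%g) = id) ?(Tmap_id _ cA)//.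
by apply/funext => x; rewrite mul1g invg1 mulg1.
Qed.

Lemma AdM x y (v : g) : Ad (x * y)%g v = Ad x (Ad y v).
Proof.
rewrite /Ad -(Tmap_comp cA cA (mdiff_conjug1 y) (mdiff_conjug1 x)).
rewrite (_ : (fun k : G => (x * y * k * (x * y)^-1)%g) = conjug x \o conjug y) //.
by apply/funext => k /=; rewrite /conjug invgM !mulgA.
Qed.

Lemma mdiff_lmul x y : mdiff A A (fun k => (x * k)%g) y (x * y)%g.
Proof.
apply: (lsmooth_mdiff cA cA) => //; apply: (lsmooth_mulg cA).
  exact: (lsmooth_cst x y cA cA).
exact: (lsmooth_id y cA).
Qed.

Lemma TL_surj x (v : tangent A x) : exists y : g, TL x y = v.
Proof.
have d1 := mdiff_lmul x^-1%g x; rewrite mulVg in d1.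
have d2 := mdiff_lmul x 1%g; rewrite mulg1 in d2.
exists (Tmap A A (fun k => (x^-1 * k)%g) x 1%g v).
rewrite /TL -(Tmap_comp cA cA d1 d2).
rewrite (_ : _ \o _ = id) ?(Tmap_id _ cA)//.
by apply/funext => k /=; rewrite mulVKg.
Qed.

(** In charts, [Ad] is the derivative of conjugation at [(u, e)] in the direction [(0, v)], that is,
    a smooth tangent map evaluated along a smooth map of [(u, v)]. *)
Lemma Ad_family i :
  linear_family (chart A i @` dom A i) (fun p : model i * g => Ad (ichart A i p.1) p.2).
Proof.
have cAA := prod_charted cA cA.
split; last by move=> u _ c x y /=; rewrite AdD AdZ.
apply: smooth_local => -[_ x0] [/= [p ip <-] _].
have p1 : dom (prod_atlas A A) (i, centre A 1%g) (p, 1%g).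
  by split=> //; exact: (dom_centre cA).
have p2 : dom A (centre A 1%g) (conjug p 1%g).
  by rewrite /conjug mulg1 mulgV; exact: (dom_centre cA).
have [W [[oW Wp] Wi Wj cf sf]] := lsmooth_charts cAA cA (lsmooth_conjug (p, 1%g)) p1 p2.
pose e := chart A (centre A 1%g) 1%g.
pose c := chart A (centre A 1%g) \o (fun x : G * G => conjug x.1 x.2) \o
  ichart (prod_atlas A A) (i, centre A 1%g).
pose W1 := dom A i `&` (fun x : G => (x, 1%g)) @^-1` W.
have oW1 : open W1.
  apply: open_preimage => //; first exact: (dom_open cA).
  move=> x _; apply: for_continuous_pair; [exact: cvg_id|exact: cst_continuous].
have W1i : W1 `<=` dom A i by move=> x [].
have o1 := chart_image_open cA oW1 W1i.
have o2 := chart_image_open cAA oW Wi.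
exists ((chart A i @` W1) `*` [set: g]); first by split => //; exists p.
pose m (y : model i * g) : (model i * g) * (model i * g) := ((y.1, e), (0, y.2)).
have o1T : open ((chart A i @` W1) `*` [set: g]) by exact: open_setXT.
have W1e u : (chart A i @` W1) u -> (chart (prod_atlas A A) (i, centre A 1%g) @` W) (u, e).
  by move=> [x [_ Wx] <-]; exists (x, 1%g).
have sm : smooth_on ((chart A i @` W1) `*` [set: g]) m.
  apply: smooth_pair => //; apply: smooth_pair => //.
  - by apply: smooth_fst => //; exact: smooth_id.
  - exact: smooth_cst.
  - exact: smooth_cst.
  - by apply: smooth_snd => //; exact: smooth_id.
have mW y : ((chart A i @` W1) `*` [set: g]) y ->
    ((chart (prod_atlas A A) (i, centre A 1%g) @` W) `*` [set: model i * g]) (m y).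
  by move=> [W1u _]; split=> //=; exact: W1e.
have sc := smooth_comp o1T (open_setXT o2) mW sm (smooth_diff sf).
apply: smooth_ext sc => //.
move=> [u v] [/= W1u _].
have dc : differentiable c (u, e) by apply: smooth_differentiable sf _; exact: W1e.
have [_ d2] := is_diff_partial_snd dc.
exact: esym (congr1 (fun h => h v) d2).
Qed.

Lemma lsmooth_family (S : topologicalType) (B : atlas R S) (E F : completeNormedModType R)
    (f : S * E -> F) p : charted B ->
  (forall i, smooth_on ((chart B i @` dom B i) `*` [set: E])
     (fun y : model i * E => f (ichart B i y.1, y.2))) ->
  lsmooth (prod_atlas B (vs_atlas E)) (vs_atlas F) f p.
Proof.
move=> cB sf; case: p => p x.
have cBE := prod_charted cB (vs_charted E).
apply: (lsmooth_vs (i := (centre B p, tt)) (W := dom B (centre B p) `*` [set: E]) cBE).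
- by apply: open_setXT; exact: dom_open.
- by split => //; exact: dom_centre.
- by move=> y [].
- rewrite /= (image_prod (chart B (centre B p)) id) image_id.
  exact: sf.
Qed.

Lemma lsmooth_Ad p : lsmooth (prod_atlas A (vs_atlas g)) (vs_atlas g)
  (fun y : G * g => Ad y.1 y.2) p.
Proof.
by apply: lsmooth_family; [exact: cA|move=> i; exact: (Ad_family i).1].
Qed.

Lemma lsmooth_Ad_vec x p : lsmooth A (vs_atlas g) (fun k => Ad k x) p.
Proof.
have cg := vs_charted g.
apply: (lsmooth_comp (f := fun k => (k, x)) cA (prod_charted cA cg) cg _ (lsmooth_Ad (p, x))).
exact: (lsmooth_pair cA cA cg (lsmooth_id p cA) (lsmooth_cst x p cA cg)).
Qed.

Lemma mdiff_Ad_vec x p : mdiff A (vs_atlas g) (fun k => Ad k x) p (Ad p x).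
Proof. exact: (lsmooth_mdiff cA (vs_charted g) (lsmooth_Ad_vec x p)). Qed.

End LieGroup.

Lemma smooth_diff_dir (R : realType) (E F : normedModType R) (U : set E) (f : E -> F) (a : E) :
  open U -> smooth_on U f -> smooth_on U (fun x => 'd f x a : F).
Proof.
move=> oU sf.
apply: (smooth_comp (f := fun x => (x, a)) oU (open_setXT oU) _ _ (smooth_diff sf)).
  by [].
by apply: smooth_pair => //; [exact: smooth_id|exact: smooth_cst].
Qed.

Lemma dual_diffP (R : realType) (Es E : completeNormedModType R) (pair : Es -> E -> R)
    (f : Es -> R^o) s t :
  predual pair -> differentiable f s -> 'd f s t = pair t (dual_diff pair f s).
Proof.
move=> [_ _ _ hl] df; have [x hx] := hl _ (diff_continuous df).
have ex_x : exists x, [set x | forall t, 'd f s t = pair t x] x by exists x.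
exact: (xgetPex 0 ex_x t).
Qed.

Section Coadjoint.
Variables (R : realType) (G : topGroupType) (A : atlas R G).
Hypothesis hG : banach_lie_group A.
Let g := lie_algebra A.
Variables (Es : completeNormedModType R) (pair : Es -> g -> R).
Hypotheses (hp : predual pair) (hco : coAd_invariant pair).

Local Notation cA := (lie_group_charted hG).

Lemma coAdP k s x : pair (coAd pair k s) x = pair s (Ad k x).
Proof.
have h : exists t, [set t | forall x, pair t x = pair s (Ad k x)] t by exact: hco.
exact: (xgetPex 0 h x).
Qed.

Lemma coAd_unique k s t : (forall x, pair t x = pair s (Ad k x)) -> coAd pair k s = t.
Proof. by move=> h; apply: (pair_injl hp) => x; rewrite coAdP h. Qed.

Lemma coAdM k h s : coAd pair (k * h)%g s = coAd pair h (coAd pair k s).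
Proof. by apply: coAd_unique => x; rewrite !coAdP AdM. Qed.

Lemma coAdD k s t : coAd pair k (s + t) = coAd pair k s + coAd pair k t.
Proof. by apply: coAd_unique => x; rewrite !(pairDl hp) !coAdP. Qed.

Lemma lsmooth_coAd p : lsmooth (prod_atlas A (vs_atlas Es)) (vs_atlas Es)
  (fun y : G * Es => coAd pair y.1 y.2) p.
Proof.
apply: lsmooth_family; first exact: cA.
move=> i k; apply: (adjoint_Ck hp k (codom_open cA i) (Ad_family hG i)).
by move=> u s x _ /=; rewrite coAdP.
Qed.

Lemma mdiff_pair_Ad s y k :
  mdiff A (vs_atlas R^o) (fun h => pair s (Ad h y) : R^o) k (pair s (Ad k y)).
Proof.
exact: (mdiff_lin (pairl_continuous (hp := hp) (s := s)) (mdiff_Ad_vec hG y k)).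
Qed.

(** Bracket identities that go beyond linearity are proved by differentiating real functions of this
    shape. *)
Lemma Tmap_pair_Ad s x y :
  Tmap A (vs_atlas R^o) (fun k => pair s (Ad k y) : R^o) 1%g (pair s (Ad 1%g y)) x =
  pair s (lie_bracket x y).
Proof.
exact: (Tmap_lin (pairl_continuous (hp := hp) (s := s)) (mdiff_Ad_vec hG y 1%g) x).
Qed.

(** Differentiate [Ad (k h k^-1) (Ad k y) = Ad k (Ad h y)] in [h] at the identity; conjugation by
    [k] has tangent map [Ad k]. *)
Lemma coAd_bracket k s x y :
  pair (coAd pair k s) (lie_bracket x y) = pair s (lie_bracket (Ad k x) (Ad k y)).
Proof.
have d1 := mdiff_pair_Ad s (Ad k y) 1%g.
have E : (fun h => pair s (Ad h (Ad k y)) : R^o) \o conjug k =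
    (fun h => pair (coAd pair k s) (Ad h y)).
  by apply/funext => h /=; rewrite coAdP -!(AdM hG) /conjug mulgVK.
have V : pair s (Ad 1%g (Ad k y)) = pair (coAd pair k s) (Ad 1%g y).
  by rewrite coAdP !(Ad1 hG).
rewrite -(Tmap_pair_Ad (coAd pair k s) x y) -V -E.
by rewrite (Tmap_comp cA cA (mdiff_conjug1 hG k) d1) Tmap_pair_Ad.
Qed.

Let comm (x : G * G) : G := (conjug x.1 x.2 * x.2^-1)%g.

Lemma lsmooth_comm p : lsmooth (prod_atlas A A) A comm p.
Proof.
have cAA := prod_charted cA cA.
apply: (lsmooth_mulg hG cAA); first exact: lsmooth_conjug.
exact: (lsmooth_invg hG cAA (lsmooth_snd _ cA cA)).
Qed.

(** [comm (k, 1) = 1] for every [k], so these derivatives all take values in the Lie algebra and can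
    be differentiated again in [k]. *)
Lemma Tmap_comm_snd k (y : g) : Tmap A A (fun h => comm (k, h)) 1%g 1%g y = Ad k y - y.
Proof.
by rewrite (Tmap_mulg hG cA (mdiff_conjug1 hG k) (mdiff_inv1 hG)) (Tmap_inv1 hG).
Qed.

Lemma Tmap_comm_fst k (x : g) : Tmap A A (fun h => comm (h, k)) 1%g 1%g x = x - Ad k x.
Proof.
rewrite (_ : (fun h => comm (h, k)) = fun h => (id h * (conjug k \o (fun h => h^-1)) h)%g).
  have dc := mdiff_comp cA cA (mdiff_inv1 hG) (mdiff_conjug1 hG k).
  rewrite (Tmap_mulg hG cA (mdiff_id 1%g cA) dc) (Tmap_id (x : tangent A 1%g) cA).
  by rewrite (Tmap_comp cA cA (mdiff_inv1 hG) (mdiff_conjug1 hG k)) (Tmap_inv1 hG) TmapN.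
by apply/funext => h; rewrite /comm /conjug /= !mulgA.
Qed.

(* The commutator map has vanishing first order terms at (1, 1); both brackets are
   its mixed second derivatives there, with opposite signs. *)
Lemma lie_bracketC x y : lie_bracket x y = - lie_bracket y x :> g.
Proof.
apply: (pair_injr hp) => s; rewrite (pairNr hp).
have cAA := prod_charted cA cA.
pose i := centre A 1%g; pose e := chart A i 1%g.
have p1 : dom (prod_atlas A A) (i, i) (1%g, 1%g) by split; exact: (dom_centre cA).
have p2 : dom A i (comm (1%g, 1%g)).
  by rewrite /comm /conjug /= invg1 !mulg1; exact: (dom_centre cA).
have [W [[oW Wp] Wi Wj _ sQ]] := lsmooth_charts cAA cA (lsmooth_comm (1%g, 1%g)) p1 p2.
pose Q := chart A i \o comm \o ichart (prod_atlas A A) (i, i).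
pose O := chart (prod_atlas A A) (i, i) @` W.
have oO : open O := chart_image_open cAA oW Wi.
have Oe : O (e, e) by exists (1%g, 1%g).
pose L := pairl hp s; have cL : continuous L := pairl_continuous (hp := hp) (s := s).
(* Testing against [s] gives a real function, as [diff_symmetric] requires. *)
pose f : model i * model i -> R^o := L \o Q.
have sf : smooth_on O f by move=> k; exact: (Ck_lin_comp oO cL (sQ k)).
have sfa a := smooth_diff_dir a oO sf.
have sfab a b := smooth_diff_dir b oO (sfa a).
have ie : ichart A i e = 1%g by rewrite /e (chartK cA) //; exact: (dom_centre cA).
have dQ p : O p -> differentiable Q p by move=> Op; exact: (smooth_differentiable sQ).
have dfE p v : O p -> 'd f p v = L ('d Q p v).
  by move=> Op; have [_ ->] := is_diff_lin_comp cL (dQ _ Op).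
have near_fst : \forall u \near e, O (u, e).
  have c : {for e, continuous (fun u : model i => (u, e))}.
    by apply: for_continuous_pair; [exact: cvg_id|exact: cst_continuous].
  by apply: c; exact: open_nbhs_nbhs.
have near_snd : \forall u \near e, O (e, u).
  have c : {for e, continuous (fun u : model i => (e, u))}.
    by apply: for_continuous_pair; [exact: cst_continuous|exact: cvg_id].
  by apply: c; exact: open_nbhs_nbhs.
have dAd z : is_diff e (fun u => pair s (Ad (ichart A i u) z) : R^o)
    (fun v => pair s (lie_bracket v z)).
  have [_ _ d] := mdiff_pair_Ad s z 1%g.
  apply: DiffDef; first exact: d.
  by apply/funext => v; exact: (Tmap_pair_Ad s v z).
(* Along [(u, e)] the inner derivative is [<s, Ad u y - y>]. *)
have h1 : 'd (fun p => 'd f p (0, y) : R^o) (e, e) (x, 0) = pair s (lie_bracket x y).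
  have [_ d1] := is_diff_partial_fst (smooth_differentiable (sfa (0, y)) Oe).
  rewrite -(congr1 (fun h => h x) d1).
  have [d2 e2] := is_diffB (dAd y) (is_diff_cst (pair s y : R^o) e).
  rewrite -(near_eq_diff _ d2) ?e2.
    by rewrite !fctE /= subr0.
  apply: filterS near_fst => u Ou; rewrite dfE //.
  have [_ d3] := is_diff_partial_snd (dQ _ Ou).
  rewrite -(congr1 (fun h => h y) d3).
  have := Tmap_comm_snd (ichart A i u) y.
  rewrite /Tmap => ->; exact: esym (pairBr hp _ _ _).
(* Along [(e, u)] the inner derivative is [<s, x - Ad u x>], whence the opposite sign. *)
have h2 : 'd (fun p => 'd f p (x, 0) : R^o) (e, e) (0, y) = - pair s (lie_bracket y x).
  have [_ d1] := is_diff_partial_snd (smooth_differentiable (sfa (x, 0)) Oe).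
  rewrite -(congr1 (fun h => h y) d1).
  have [d2 e2] := is_diffB (is_diff_cst (pair s x : R^o) e) (dAd x).
  rewrite -(near_eq_diff _ d2) ?e2.
    by rewrite !fctE /= sub0r.
  apply: filterS near_snd => u Ou; rewrite dfE //.
  have [_ d3] := is_diff_partial_fst (dQ _ Ou).
  rewrite -(congr1 (fun h => h x) d3).
  have := Tmap_comm_fst (ichart A i u) x.
  rewrite /Tmap => ->; exact: esym (pairBr hp _ _ _).
rewrite -h1 -h2.
apply: (diff_symmetric oO Oe).
- by move=> p; exact: smooth_differentiable.
- by move=> p; exact: smooth_differentiable (sfa _).
- by move=> p; exact: smooth_differentiable (sfa _).
- exact: (smooth_continuous (sfab _ _) Oe).
- exact: (smooth_continuous (sfab _ _) Oe).
Qed.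

Lemma lie_bracketDl x y z : lie_bracket (x + y) z = lie_bracket x z + lie_bracket y z :> g.
Proof. by rewrite /lie_bracket TmapD. Qed.

Lemma lie_bracketNl x y : lie_bracket (- x) y = - lie_bracket x y :> g.
Proof. by rewrite /lie_bracket TmapN. Qed.

Lemma lie_bracketDr x y z : lie_bracket x (y + z) = lie_bracket x y + lie_bracket x z :> g.
Proof. by rewrite lie_bracketC lie_bracketDl opprD -!lie_bracketC. Qed.

End Coadjoint.

(** * Submanifolds and submersions *)

Section NearEq.
Variables (R : realType) (S T : topologicalType) (A : atlas R S) (B : atlas R T).
Variables (f h : S -> T) (p : S).
Hypotheses (cA : charted A) (fh : \forall x \near p, f x = h x).

Lemma lsmooth_near_eq : lsmooth A B f p -> lsmooth A B h p.
Proof.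
move=> [i [j [W [[oW Wp] Wi Wj cf sf]]]].
have [V [oV Vp] Vfh] : exists2 V, open V /\ V p & V `<=` [set x | f x = h x].
  have : nbhs p [set x | f x = h x] by exact: fh.
  by rewrite nbhsE => -[V oVp VP]; exists V.
have WVi : W `&` V `<=` dom A i by move=> x [/Wi].
exists i, j, (W `&` V); split => //.
- by split; [exact: openI|].
- by move=> x [/Wj + /Vfh /= fhx]; rewrite /= fhx.
- move=> x [/cf cfx Vx]; apply: near_eq_continuous cfx.
  by near=> y; apply: Vfh; near: y; exact: open_nbhs_nbhs.
apply: (smooth_ext (chart_image_open cA (openI oW oV) WVi) (f := chart B j \o f \o ichart A i)).
  by move=> _ [x [/Wi ix /Vfh /= fhx] <-] /=; rewrite (chartK cA ix) fhx.
by apply: smooth_sub sf => _ [x [Wx _] <-]; exists x.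
Unshelve. all: by end_near. Qed.

Lemma Tmap_near_eq q v : mdiff A B f p q -> Tmap A B f p q v = Tmap A B h p q v.
Proof.
move=> [cf fq df].
have ci : ichart A (centre A p) x @[x --> chart A (centre A p) p] --> p.
  have := ichart_continuous cA (dom_centre cA p).
  by rewrite /prop_for /continuous_at (chartK cA (dom_centre cA p)).
pose rep (k : S -> T) := chart B (centre B q) \o k \o ichart A (centre A p).
have e : \forall x \near chart A (centre A p) p, rep f x = rep h x.
  near=> x; rewrite /rep /=; congr (chart B _ _); near: x.
  exact: ci _ fh.
exact: (congr1 (fun L => L v) (near_eq_diff e df)).
Unshelve. all: by end_near. Qed.

End NearEq.

Section VectorValued.
Variables (R : realType) (S : topologicalType) (A : atlas R S).
Hypothesis cA : charted A.

Lemma lsmooth_vs_comp (E F : completeNormedModType R) (U : set E) (f : S -> E) (k : E -> F) p :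
  open U -> U (f p) -> smooth_on U k ->
  lsmooth A (vs_atlas E) f p -> lsmooth A (vs_atlas F) (k \o f) p.
Proof.
move=> oU Ufp sk sf; apply: (lsmooth_comp cA (vs_charted E) (vs_charted F) sf).
exact: (smooth_lsmooth oU Ufp sk).
Qed.

Lemma lsmooth_lin (E F : completeNormedModType R) (f : S -> E) (L : {linear E -> F}) p :
  continuous L -> lsmooth A (vs_atlas E) f p -> lsmooth A (vs_atlas F) (L \o f) p.
Proof.
by move=> cL; apply: (lsmooth_vs_comp (U := setT)) => //; [exact: openT|exact: smooth_lin].
Qed.

Lemma lsmooth_pair_vs (E F : completeNormedModType R) (f : S -> E) (h : S -> F) p :
  lsmooth A (vs_atlas E) f p -> lsmooth A (vs_atlas F) h p ->
  lsmooth A (vs_atlas (E * F)%type) (fun x => (f x, h x)) p.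
Proof.
move=> sf sh.
have [i [j [W [W1 W2 _ W4 W5]]]] := lsmooth_pair cA (vs_charted E) (vs_charted F) sf sh.
by exists i, tt, W; split.
Qed.

Lemma lsmooth_add (E : completeNormedModType R) (f h : S -> E) p :
  lsmooth A (vs_atlas E) f p -> lsmooth A (vs_atlas E) h p ->
  lsmooth A (vs_atlas E) (fun x => f x + h x) p.
Proof.
move=> sf sh.
apply: (lsmooth_vs_comp (k := fun y : E * E => y.1 + y.2) openT I _ (lsmooth_pair_vs sf sh)).
have oT : open [set: E * E] by exact: openT.
by apply: smooth_add => //; [apply: smooth_fst|apply: smooth_snd] => //; exact: smooth_id.
Qed.

Lemma Tmap_vs_target (E : completeNormedModType R) (f : S -> E) p q r v :
  Tmap A (vs_atlas E) f p q v = Tmap A (vs_atlas E) f p r v.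
Proof. by []. Qed.

Lemma Tmap_addc (E : completeNormedModType R) (f : S -> E) p q r c v :
  mdiff A (vs_atlas E) f p q ->
  Tmap A (vs_atlas E) (fun x => f x + c) p r v = Tmap A (vs_atlas E) f p q v.
Proof.
move=> [_ _ df].
have [_ e] := is_diffD (differentiableP df) (is_diff_cst c (chart A (centre A p) p)).
by have := congr1 (fun L => L v) e; rewrite !fctE addr0.
Qed.

End VectorValued.

Section Submanifold.
Variables (R : realType) (S T : topologicalType) (A : atlas R S) (B : atlas R T).
Variable f : S -> T.
Hypotheses (cA : charted A) (cB : charted B).

(** In adapted charts the map is the inclusion [x |-> (x, 0)]. *)
Lemma submanifold_lsmooth p : submanifold A B f -> lsmooth A B f p.
Proof.
move=> [_ /(_ p)[E1 [E2 [V [phi [psi [psi' [aB Vfp Vf aA]]]]]]]].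
have [[oV oE K] _ _ _ _] := aB.
have [[ofV _ _] _ _ _ _] := aA.
have phif q : V (f q) -> phi (f q) = ((phi (f q)).1, 0).
  move=> Vfq; have [_] : (V `&` [set q | (phi q).2 = 0]) (f q).
    by rewrite -Vf; split => //; exists q.
  by rewrite [phi _ in RHS]surjective_pairing /= => <-; case: (phi _).
have s1 : lsmooth A (vs_atlas (E1 * E2)%type) (fun q => ((phi (f q)).1, 0 : E2)) p.
  apply: lsmooth_pair_vs => //.
    exact: (admissible_lsmooth cA aA).
  exact: (lsmooth_cst _ _ cA (vs_charted E2)).
apply: (lsmooth_near_eq (f := psi \o (fun q => ((phi (f q)).1, 0 : E2)))) => //.
  have fVp : nbhs p (f @^-1` V) by exact: open_nbhs_nbhs.
  by apply: filterS fVp => q Vfq /=; rewrite -phif // K // inE.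
apply: (lsmooth_comp cA (vs_charted _) cB s1); rewrite -phif //.
exact: (admissible_inv_lsmooth cB aB).
Qed.

End Submanifold.

Section Submersion.
Variables (R : realType) (S T : topologicalType) (A : atlas R S) (B : atlas R T).
Variable f : S -> T.
Hypotheses (cA : charted A) (cB : charted B) (hf : submersion A B f).

(** In adapted charts [f] is the first projection; the section freezes the second coordinate at its
    value at [p]. *)
Lemma submersion_section p : exists s : T -> S,
  [/\ s (f p) = p, lsmooth B A s (f p) & \forall m \near f p, f (s m) = m].
Proof.
have [_ /(_ p)[E1 [E2 [U [phi [psi [V [phi' [psi' [aA aB Up fUV hphi]]]]]]]]]] := hf.
have [[oU oE K] _ _ _ _] := aA; have [[oV oE' K'] _ _ _ _] := aB.
have Vfp : V (f p) by apply: fUV; exists p.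
pose c := (phi p).2; pose s m := psi (phi' m, c).
have phip : phi p = (phi' (f p), c) by rewrite hphi // /c; case: (phi p).
have s1 : lsmooth B (vs_atlas (E1 * E2)%type) (fun m => (phi' m, c)) (f p).
  apply: lsmooth_pair_vs => //.
    exact: (admissible_lsmooth cB aB).
  exact: (lsmooth_cst _ _ cB (vs_charted E2)).
exists s; split.
- by rewrite /s -phip K // inE.
- apply: (lsmooth_comp cB (vs_charted _) cA s1); rewrite -phip.
  exact: (admissible_inv_lsmooth cA aA).
have [i [j [W [[_ Wp] _ _ cs _]]]] := s1.
have nE : nbhs (phi' (f p), c) (phi @` U).
  by rewrite -phip; apply: open_nbhs_nbhs; split => //; exists p.
near=> m.
have Vm : V m by near: m; exact: open_nbhs_nbhs.
have [q Uq qm] : (phi @` U) (phi' m, c) by near: m; exact: cs _ Wp _ nE.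
rewrite /s -qm K ?inE//.
have fq : V (f q) by apply: fUV; exists q.
rewrite -[m]K' ?inE// -[f q]K' ?inE//; congr psi'.
by rewrite hphi // qm.
Unshelve. all: by end_near. Qed.

(** Near [f p], [k] is [(k \o f) \o s] for a smooth local section [s]. *)
Lemma submersion_lsmooth_descent (Z : topologicalType) (C : atlas R Z) (k : T -> Z) p :
  charted C -> lsmooth A C (k \o f) p -> lsmooth B C k (f p).
Proof.
move=> cC sk; have [s [sp ss fs]] := submersion_section p.
apply: (lsmooth_near_eq (f := (k \o f) \o s)) => //.
  by apply: filterS fs => m /= ->.
by apply: (lsmooth_comp cB cA cC ss); rewrite sp.
Qed.

Lemma submersion_mdiff p : mdiff A B f p (f p).
Proof.
apply: (lsmooth_mdiff cA cB) => //.
exact: (msmooth_on_lsmooth cA cB openT I hf.1).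
Qed.

Lemma submersion_Tmap_surj p v : exists u, Tmap A B f p (f p) u = v.
Proof.
have [s [sp ss fs]] := submersion_section p.
have ds := lsmooth_mdiff cB cA ss sp.
exists (Tmap B A s (f p) p v).
have df := submersion_mdiff p.
rewrite -(Tmap_comp cB cA ds df).
rewrite (Tmap_near_eq (h := id) cB _ _ (mdiff_comp cB cA ds df)) //.
exact: Tmap_id.
Qed.

End Submersion.

(** * Symplectic induction *)

Lemma multiplicative1 (H G : groupType) (f : {multiplicative H -> G}) : f 1%g = 1%g.
Proof. by apply: (mulgI (f 1%g)); rewrite -gmulfM !mulg1. Qed.

Lemma multiplicativeV (H G : groupType) (f : {multiplicative H -> G}) x :
  f x^-1%g = (f x)^-1%g.
Proof. by apply: (mulgI (f x)); rewrite -gmulfM !mulgV multiplicative1. Qed.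

Section Subgroup.
Variables (R : realType) (G H : topGroupType) (AG : atlas R G) (AH : atlas R H).
Hypotheses (hG : banach_lie_group AG) (hH : banach_lie_group AH).
Variable iota : {multiplicative H -> G}.
Hypothesis hiota : submanifold AH AG iota.

Let cG := lie_group_charted hG.
Let cH := lie_group_charted hH.
Let Ti : lie_algebra AH -> lie_algebra AG := Tmap AH AG iota 1%g 1%g.

Lemma mdiff_iota1 : mdiff AH AG iota 1%g 1%g.
Proof.
by apply: (lsmooth_mdiff cH cG); [exact: submanifold_lsmooth|rewrite multiplicative1].
Qed.

Lemma Ad_iota h x : Ad (iota h) (Ti x) = Ti (Ad h x).
Proof.
rewrite /Ad /Ti -(Tmap_comp cH cG mdiff_iota1 (mdiff_conjug1 hG (iota h))).
rewrite -(Tmap_comp cH cH (mdiff_conjug1 hH h) mdiff_iota1).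
rewrite (_ : conjug (iota h) \o iota = iota \o conjug h) //.
by apply/funext => k; rewrite /conjug /= !gmulfM multiplicativeV.
Qed.

Section Bracket.
Variables (gs : completeNormedModType R) (pairG : gs -> lie_algebra AG -> R).
Hypotheses (hpG : predual pairG).

(* Differentiate [pairG s (Ad (iota h) z) = 0] at [h = 1]. *)
Lemma pair_bracket_iota0 s z y : (forall h, pairG s (Ad (iota h) z) = 0) ->
  pairG s (lie_bracket (Ti y) z) = 0.
Proof.
move=> h0; have d := mdiff_pair_Ad hG hpG s z 1%g.
rewrite -(Tmap_pair_Ad hG hpG) -(Tmap_comp cH cG mdiff_iota1 d).
rewrite (_ : _ \o iota = fun=> 0).
  exact: (@Tmap_cst _ _ _ AH (vs_atlas R^o) 1%g (0 : R^o) y).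
by apply/funext => k /=.
Qed.

End Bracket.
End Subgroup.

Theorem proposition3p5 (R : realType)
  (G H : topGroupType) (AG : atlas R G) (AH : atlas R H)
  (hG : banach_lie_group AG) (hH : banach_lie_group AH)
  (iota : {multiplicative H -> G})
  (hiota : submanifold AH AG iota) (hclosed : closed (range iota))
  (Ti := Tmap AH AG iota 1%g 1%g : lie_algebra AH -> lie_algebra AG)
  (gs hs hp : completeNormedModType R)
  (pairG : gs -> lie_algebra AG -> R) (pairH : hs -> lie_algebra AH -> R)
  (hpG : predual pairG) (hpH : predual pairH)
  (hcoG : coAd_invariant pairG) (hcoH : coAd_invariant pairH)
  (js : {linear hs -> gs}) (jp : {linear hp -> gs})
  (qs : {linear gs -> hs}) (qp : {linear gs -> hp})
  (hsplit : splitting js jp qs qp)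
  (hpair : forall s x, pairG (js s) (Ti x) = pairH s x)
  (hinvs : forall h s, range js (coAd pairG (iota h) (js s)))
  (hinvp : forall h t, range jp (coAd pairG (iota h) (jp t)))
  (hann : [set x | forall t, pairG (jp t) x = 0] = range Ti)
  (P : topologicalType) (AP : atlas R P) (hP : banach_manifold AP)
  (w : form2 AP) (hw : weak_symplectic w)
  (actP : H -> P -> P)
  (hactP : smooth_action AH AP actP) (hsymp : symplectic_action w actP)
  (expH : lie_algebra AH -> H) (hexp : is_exp expH)
  (JP : P -> hs) (hJP : msmooth AP (vs_atlas hs) JP)
  (hJPeq : equivariant pairH actP JP)
  (hJPham : forall z, hamiltonian_on w [set: P] (fun p => pairH (JP p) z)
                        (generator AP expH actP z))
  (M : topologicalType) (AM : atlas R M) (hM : banach_manifold AM)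
  (pi0 : (G * P * hp)%type -> M)
  (hpi0surj : forall m, exists y, pi0 y = m)
  (hpi0fib : forall y y', pi0 y = pi0 y' <->
     exists h : H, y' = (y.1.1 * (iota h)^-1, actP h y.1.2,
                         qp (coAd pairG (iota h)^-1 (jp y.2)))%g)
  (hpi0sub : submersion (prod_atlas (prod_atlas AG AP) (vs_atlas hp)) AM pi0)
  (Tpi0 := fun g p t (v : tangent AG g) (a : tangent AP p) (u : hp) =>
     Tmap (prod_atlas (prod_atlas AG AP) (vs_atlas hp)) AM pi0
       (g, p, t) (pi0 (g, p, t)) (v, a, u))
  (Om : form2 AM) (hOm : weak_symplectic Om)
  (hOmE : forall g p t (x y : lie_algebra AH) (xp yp : lie_algebra AG)
     (a b : tangent AP p) (mu nu : hp),
     (forall s, pairG (js s) xp = 0) -> (forall s, pairG (js s) yp = 0) ->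
     Om (pi0 (g, p, t)) (Tpi0 g p t (TL g (Ti x + xp)) a mu)
                        (Tpi0 g p t (TL g (Ti y + yp)) b nu) =
       w p a b
       + pairH (Tmap AP (vs_atlas hs) JP p (JP p) b) x + pairG (jp nu) xp
       - pairH (Tmap AP (vs_atlas hs) JP p (JP p) a) y - pairG (jp mu) yp
       + pairG (js (JP p)) (lie_bracket (Ti x) (Ti y))
       + pairG (jp t) (lie_bracket xp (Ti y) + lie_bracket (Ti x) yp)
       + pairG (js (JP p) + jp t) (lie_bracket xp yp)) :
  exists (actM : G -> M -> M) (JM : M -> gs),
    [/\ forall g' g p t, actM g' (pi0 (g, p, t)) = pi0 ((g' * g)%g, p, t),
        forall g p t,
          JM (pi0 (g, p, t)) = coAd pairG g^-1%g (js (JP p) + jp t),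
        is_action actM,
        equivariant pairG actM JM
      & momentum_map pairG Om JM].
Proof.
have cG := lie_group_charted hG; have cH := lie_group_charted hH.
have cP := manifold_charted hP; have cM := manifold_charted hM.
have chs := vs_charted hs; have chp := vs_charted hp; have cgs := vs_charted gs.
have cGP := prod_charted cG cP; have cX := prod_charted cGP chp.
have [[cjs cjp cqs cqp] [jsK jpK] [qpjs qsjp] hdec] := hsplit.
have AdT h x : Ad (iota h) (Ti x) = Ti (Ad h x) := Ad_iota hG hH hiota h x.
have iota_br s z y : (forall h, pairG s (Ad (iota h) z) = 0) ->
    pairG s (lie_bracket (Ti y) z) = 0.
  exact: (pair_bracket_iota0 hG hH hiota hpG).
clearbody Ti.
have js_coAd h s : js (coAd pairH h s) = coAd pairG (iota h) (js s).
  have [s' _ hs'] := hinvs h s; rewrite -hs'; congr (js _).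
  apply: (coAd_unique hpH hcoH) => x.
  by rewrite -hpair hs' (coAdP hcoG) -hpair AdT.
have jp_coAd h t : jp (qp (coAd pairG (iota h) (jp t))) = coAd pairG (iota h) (jp t).
  by have [t' _ <-] := hinvp h t; rewrite jpK.
pose sig p t := js (JP p) + jp t.
pose K (y : G * P * hp) := coAd pairG y.1.1^-1%g (sig y.1.2 y.2).
(* Replacing [(g, p, t)] by its translate under [h] applies [coAd] of [h^-1] to both summands of
   [sig]; this cancels the [h] in [(g h^-1)^-1 = h g^-1]. *)
have K_inv y y' : pi0 y = pi0 y' -> K y = K y'.
  case: y y' => [[g p] t] y' /hpi0fib[h ->]; rewrite /K /sig /= hJPeq js_coAd.
  rewrite -multiplicativeV jp_coAd -(coAdD hpG hcoG) -(coAdM hG hpG hcoG).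
  by rewrite invgM !multiplicativeV invgK mulKg.
have act_inv g' y y' : pi0 y = pi0 y' ->
    pi0 ((g' * y.1.1)%g, y.1.2, y.2) = pi0 ((g' * y'.1.1)%g, y'.1.2, y'.2).
  move=> /hpi0fib[h ->]; apply/hpi0fib; exists h => /=.
  by rewrite mulgA.
(* Representatives are arbitrary; [act_inv] and [K_inv] make both maps independent of them. *)
have [rep pi0rep] := choice hpi0surj.
pose actM g' m := pi0 ((g' * (rep m).1.1)%g, (rep m).1.2, (rep m).2).
pose JM m := K (rep m).
have actME g' g p t : actM g' (pi0 (g, p, t)) = pi0 ((g' * g)%g, p, t).
  exact: (act_inv g' (rep (pi0 (g, p, t))) (g, p, t)).
have JME y : JM (pi0 y) = K y by exact: K_inv (pi0rep _).
clearbody actM JM; exists actM, JM; split.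
- exact: actME.
- by move=> g p t; rewrite JME.
- split=> [m|g g' m]; have [[[k p] t] <-] := hpi0surj m; rewrite !actME.
    by rewrite mul1g.
  by rewrite mulgA.
- move=> g m; have [[[k p] t] <-] := hpi0surj m; rewrite actME !JME /K /=.
  by rewrite invgM (coAdM hG hpG hcoG).
have lJP p : lsmooth AP (vs_atlas hs) JP p by exact: (msmooth_on_lsmooth cP chs openT I hJP).
have lK y : lsmooth (prod_atlas (prod_atlas AG AP) (vs_atlas hp)) (vs_atlas gs) K y.
  have l1 := lsmooth_fst y cGP chp.
  have l11 := lsmooth_comp cX cGP cG l1 (lsmooth_fst y.1 cG cP).
  have l12 := lsmooth_comp cX cGP cP l1 (lsmooth_snd y.1 cG cP).
  have l2 := lsmooth_snd y cGP chp.
  have lV := lsmooth_invg hG cX l11.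
  have lJ := lsmooth_lin cX cjs (lsmooth_comp cX cP chs l12 (lJP y.1.2)).
  have lsig := lsmooth_add cX lJ (lsmooth_lin cX cjp l2).
  have := lsmooth_pair cX cG cgs lV lsig.
  move=> lp.
  exact: (lsmooth_comp cX (prod_charted cG cgs) cgs lp (lsmooth_coAd hG hpG hcoG _)).
have lJM m : lsmooth AM (vs_atlas gs) JM m.
  have [y <-] := hpi0surj m.
  apply: (submersion_lsmooth_descent cX cM hpi0sub cgs).
  have -> : JM \o pi0 = K by apply/funext => z; exact: JME.
  exact: lK.
split; first exact: (lsmooth_msmooth cM cgs lJM).
move=> W phi psi U X Y oW sphi spsi oU UW hX hY m Um.
have [[[g p] t] gpt] := hpi0surj m; subst m.
have jp_perp t' x : pairG (jp t') (Ti x) = 0.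
  have : [set x | forall t, pairG (jp t) x = 0] (Ti x) by rewrite hann; exists x.
  exact.
have decomp (z : lie_algebra AG) : exists x xp,
    z = Ti x + xp /\ forall s, pairG (js s) xp = 0.
  (* The splitting of [gs] is dualized: [z] restricted to the summand [hs] is represented by some
     [x0] annihilating [hp], hence in the range of [Ti], and [z - x0] annihilates [hs]. *)
  pose L : {linear gs -> R^o} := pairr hpG z \o (js \o qs).
  have cL : continuous L.
    move=> s; apply: continuous_comp; last exact: (pairr_continuous (hp := hpG)).
    by apply: continuous_comp; [exact: cqs|exact: cjs].
  have [_ _ _ /(_ L cL)[x0 hx0]] := hpG.
  have [x _ xx0] : range Ti x0.
    by rewrite -hann => t' /=; rewrite -hx0 /= qsjp linear0 (pair0l hpG).
  exists x, (z - x0); split; first by rewrite xx0 addrC subrK.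
  by move=> s; rewrite (pairBr hpG) -hx0 /= jsK subrr.
(* Unification must not unfold the bracket. *)
have [br brE] : exists br, br = @lie_bracket R G AG by exists (@lie_bracket R G AG).
have brDl x y z : br (x + y) z = br x z + br y z by rewrite brE lie_bracketDl.
have brDr x y z : br x (y + z) = br x y + br x z by rewrite brE (lie_bracketDr hG hpG).
have brC x y : br x y = - br y x by rewrite brE (lie_bracketC hG hpG).
rewrite -brE in hOmE.
(* The annihilator of [hs] is stable under [Ad] of [H], and infinitesimally under brackets with its
   Lie algebra. *)
have js_br s y xp : (forall s, pairG (js s) xp = 0) -> pairG (js s) (br (Ti y) xp) = 0.
  move=> hxp; rewrite brE; apply: iota_br => h; rewrite -(coAdP hcoG).
  by have [s' _ <-] := hinvs h s.
have jp_br t' x y : pairG (jp t') (br (Ti x) (Ti y)) = 0.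
  by rewrite brE; apply: iota_br => h; rewrite AdT jp_perp.
have [[wlin walt _] _ _] := hw; have [_ _ Om_inj] := hOm.
have w0 b : w p 0 b = 0.
  have := wlin p b 1 0 0; rewrite scale1r addr0 mul1r => h.
  have wb0 : w p b 0 = 0 by apply: (addrI (w p b 0)); rewrite addr0 -h.
  by rewrite walt wb0 oppr0.
pose TJP b := Tmap AP (vs_atlas hs) JP p (JP p) b.
have OmK z eta b nu :
    Om (pi0 (g, p, t)) (Tpi0 g p t (TL g z) 0 0) (Tpi0 g p t (TL g eta) b nu) =
    pairG (sig p t) (br z eta) + pairG (js (TJP b)) z + pairG (jp nu) z.
  have [x [xp [-> hxp]]] := decomp z; have [y [yp [-> hyp]]] := decomp eta.
  rewrite hOmE // w0 linear0 (pair0l hpG) Tmap0 (pair0l hpH).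
  (* The bracket terms of [Om] are those of [<sig p t, [x + xp, y + yp]>] except for three, which
     vanish: [JP p] on the two mixed brackets and [t] on the bracket of [x] and [y]. *)
  rewrite brDl !brDr /sig !(pairDl hpG) !(pairDr hpG).
  have e1 : pairG (js (JP p)) (br xp (Ti y)) = 0.
    by rewrite brC (pairNr hpG) (js_br _ _ _ hxp) oppr0.
  rewrite e1 (js_br _ x _ hyp) (jp_br t x y) (jp_perp nu x) (hpair (TJP b) x).
  by rewrite (hxp (TJP b)) -/(TJP b); ring.
have dJM m : mdiff AM (vs_atlas gs) JM m (JM m) := lsmooth_mdiff cM cgs (lJM m) erefl.
have dpi0 := submersion_mdiff cX cM hpi0sub (g, p, t).
have TK xi eta b nu :
    pairG (Tmap AM (vs_atlas gs) JM (pi0 (g, p, t)) (JM (pi0 (g, p, t)))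
      (Tpi0 g p t (TL g eta) b nu)) xi =
    pairG (sig p t) (br (Ad g^-1%g xi) eta) + pairG (js (TJP b)) (Ad g^-1%g xi) +
    pairG (jp nu) (Ad g^-1%g xi).
  set z := Ad g^-1%g xi.
  pose Kx y : R^o := pairG (K y) xi.
  have lKx y : lsmooth (prod_atlas (prod_atlas AG AP) (vs_atlas hp)) (vs_atlas R^o) Kx y.
    exact: (lsmooth_lin cX (pairr_continuous (hp := hpG) (x := xi)) (lK y)).
  have cR := vs_charted R^o.
  have [q0 q0E] : exists q0 : R^o, q0 = pairr hpG xi (JM (pi0 (g, p, t))) by eexists.
  have Kq0 : Kx (g, p, t) = q0 by rewrite q0E JME.
  have dKx := lsmooth_mdiff cX cR (lKx (g, p, t)) Kq0.
  have lKt : lsmooth (prod_atlas AG AP) (vs_atlas R^o) (fun x => Kx (x, t)) (g, p).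
    apply: (lsmooth_comp (f := fun x => (x, t)) cGP cX cR _ (lKx _)).
    exact: (lsmooth_pair cGP cGP chp (lsmooth_id _ cGP) (lsmooth_cst _ _ cGP chp)).
  have dKt := lsmooth_mdiff cGP cR lKt Kq0.
  have lKg : lsmooth AG (vs_atlas R^o) (fun x => Kx (x, p, t)) g.
    apply: (lsmooth_comp (f := fun x => (x, p)) cG cGP cR _ lKt).
    exact: (lsmooth_pair cG cG cP (lsmooth_id _ cG) (lsmooth_cst _ _ cG cP)).
  have dKg := lsmooth_mdiff cG cR lKg Kq0.
  have KxE g' p' t' : Kx (g', p', t') = pairG (sig p' t') (Ad g'^-1%g xi).
    by rewrite /Kx /K (coAdP hcoG).
  (* The derivative is computed upstairs, where [JM \o pi0 = K] is explicit, one factor of the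
     product at a time. *)
  have -> : pairG (Tmap AM (vs_atlas gs) JM (pi0 (g, p, t)) (JM (pi0 (g, p, t)))
      (Tpi0 g p t (TL g eta) b nu)) xi =
      Tmap (prod_atlas (prod_atlas AG AP) (vs_atlas hp)) (vs_atlas R^o) Kx
     (g, p, t) q0 (TL g eta, b, nu).
    rewrite /Tpi0 -(Tmap_comp cX cM dpi0 (dJM _)).
    have dK := mdiff_comp cX cM dpi0 (dJM _).
    rewrite -[LHS](Tmap_lin (pairr_continuous (hp := hpG) (x := xi)) dK).
    have -> : pairr hpG xi \o (JM \o pi0) = Kx.
      by apply/funext => y; rewrite /= JME.
    by rewrite -q0E.
  rewrite (Tmap_prod cGP chp dKx) (Tmap_prod cG cP dKt); congr (_ + _ + _).
  (* Along [k |-> g k] the function is [<sig p t, Ad k^-1 z>]; inversion contributes [- eta], and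
     antisymmetry turns [[- eta, z]] into [[z, eta]]. *)
  - have d1 := mdiff_lmul hG g 1%g; rewrite mulg1 in d1.
    rewrite /TL -(Tmap_comp cG cG d1 dKg).
    have d2 := mdiff_pair_Ad hG hpG (sig p t) z 1%g.
    have -> : br z eta = lie_bracket (- eta) z.
      by rewrite lie_bracketNl brC brE.
    rewrite -(Tmap_pair_Ad hG hpG) -(Tmap_inv1 hG) -(Tmap_comp cG cG (mdiff_inv1 hG) d2).
    have -> : (fun x => Kx (x, p, t)) \o (fun k => (g * k)%g) =
        (fun h => pairG (sig p t) (Ad h z) : R^o) \o (fun h => h^-1%g).
      by apply/funext => k; rewrite /= KxE invgM (AdM hG).
    exact: Tmap_vs_target.
  - pose L : {linear hs -> R^o} := pairr hpG z \o js.
    have cL : continuous L.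
      by move=> s; apply: continuous_comp; [exact: cjs|exact: (pairr_continuous (hp := hpG))].
    have dJ : mdiff AP (vs_atlas hs) JP p (JP p) := lsmooth_mdiff cP chs (lJP p) erefl.
    (* With [g] and [t] fixed, [Kx] is a continuous linear functional of [JP] plus a constant. *)
    rewrite (_ : (fun p' => Kx (g, p', t)) =
      fun p' => (L \o JP) p' + (pairG (jp t) z : R^o)).
      rewrite (Tmap_addc _ _ _ (mdiff_lin cL dJ)) (Tmap_lin cL dJ); reflexivity.
    by apply/funext => p'; rewrite KxE /sig (pairDl hpG).
  - pose L : {linear hp -> R^o} := pairr hpG z \o jp.
    have cL : continuous L.
      by move=> s; apply: continuous_comp; [exact: cjp|exact: (pairr_continuous (hp := hpG))].
    have dI := mdiff_id t chp.
    rewrite (_ : (fun t' => Kx (g, p, t')) =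
      fun t' => (L \o id) t' + (pairG (js (JP p)) z : R^o)).
      rewrite (Tmap_addc _ _ _ (mdiff_lin cL dI)) (Tmap_lin cL dI) (Tmap_id _ chp); reflexivity.
    by apply/funext => t'; rewrite KxE /sig (pairDl hpG) addrC.
(* The infinitesimal generator of the action of [G] at this point, since
   [exp (r xi) g = g exp (r Ad g^-1 xi)]. *)
pose gen xi := Tpi0 g p t (TL g (Ad g^-1%g xi)) 0 0.
have gen_Om xi v : Om (pi0 (g, p, t)) (gen xi) v =
    pairG (Tmap AM (vs_atlas gs) JM (pi0 (g, p, t)) (JM (pi0 (g, p, t))) v) xi.
  (* Every tangent vector of [M] here comes from upstairs, and its group component is a left
     translate. *)
  have [[[v1 b] nu] <-] := submersion_Tmap_surj cX cM hpi0sub (p := (g, p, t)) v.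
  by have [eta <-] := TL_surj hG v1; rewrite OmK TK.
have ham f Z : smooth_on W f -> hamiltonian_on Om U (f \o JM) Z ->
    Z (pi0 (g, p, t)) = gen (dual_diff pairG f (JM (pi0 (g, p, t)))).
  move=> sf [_ _ hZ]; apply: Om_inj; apply/funext => v.
  rewrite -hZ // gen_Om.
  have df : differentiable f (JM (pi0 (g, p, t))) by apply: smooth_differentiable sf (UW _ Um).
  rewrite (Tmap_comp cM cgs (dJM _) (mdiff_vs df)) Tmap_vs.
  exact: dual_diffP.
(* On two generators only the bracket term of [TK] survives; [coAd_bracket] identifies it with the
   Lie-Poisson bracket at [coAd] of [sig p t]. *)
rewrite (ham _ _ sphi hX) (ham _ _ spsi hY) gen_Om /gen TK.
rewrite /TJP Tmap0 !linear0 !(pair0l hpG) !addr0 JME /K /=.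
by rewrite /lie_poisson (coAd_bracket hG hpG hcoG) brE.
Qed.
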